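(* Let $R$ be a Noetherian commutative ring with non-zero identity and $I$ an ideal of $R$. Let $M$ be a finitely generated $R$-module and $N$ an $R$-module. If $t$ is a non-negative integer such that $R^iD_I(M,N)$ is finitely generated for all $i<t$, then $\mathrm{Hom}_R(R/I, R^tD_I(M,N))$ is a finitely generated $R$-module.
   Context: For $R$-modules $M,N$, the generalized ideal transform is $D_I(M,N)=\varinjlim_n \mathrm{Hom}_R(I^nM,N)$, the transition maps being restriction along $I^{j}M\subseteq I^{i}M$ for $i\le j$. $R^iD_I(M,-)$ denotes the $i$-th right derived functor of the functor $D_I(M,-)$ (so $R^0D_I(M,-)=D_I(M,-)$); it is isomorphic to $\varinjlim_n \mathrm{Ext}^i_R(I^nM,-)$. *)

(* Defs.v *)
From HB Require Import structures.
From mathcomp Require Import all_boot all_algebra.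
From mathcomp Require Import generic_quotient boolp.

Set Implicit Arguments.
Unset Strict Implicit.
Unset Printing Implicit Defensive.

Import GRing.Theory.
Local Open Scope ring_scope.
Local Open Scope quotient_scope.

(* A submodule of V is an S : submodClosed V, i.e. a boolean predicate closed
   under the module operations; since boolp makes every Prop decidable, this is
   no restriction. In particular an ideal of R is a submodClosed R^o (and is
   allowed to be the whole of R, unlike the idealr of ring_quotient). *)

Section Submodule.
Variables (R : comNzRingType) (V : lmodType R).
Implicit Type S : submodClosed V.

Record submod S := Submod { submod_val :> V; _ : submod_val \in S }.

HB.instance Definition _ S := [isSub for @submod_val S].
HB.instance Definition _ S := [Choice of submod S by <:].
HB.instance Definition _ S := [SubChoice_isSubLmodule of submod S by <:].

Definition spanb (A : V -> Prop) : {pred V} := fun x =>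
  `[< exists n (c : 'I_n -> R) (a : 'I_n -> V),
        (forall i, A (a i)) /\ x = \sum_(i < n) c i *: a i >].

Lemma spanb_closed A : subsemimod_closed (spanb A).
Proof.
split; [split|].
- apply/asboolP; exists 0%N, (fun=> 0), (fun=> 0).
  by split=> [[]|]; rewrite ?big_ord0.
- move=> x y /asboolP[n [c [a [Aa ->]]]] /asboolP[m [d [b [Ab ->]]]].
  apply/asboolP; exists (n + m)%N.
  exists (fun i => match split i with inl j => c j | inr j => d j end).
  exists (fun i => match split i with inl j => a j | inr j => b j end).
  split=> [i|]; first by case: split.
  rewrite big_split_ord /=; congr (_ + _); apply: eq_bigr => i _.
    by case: splitP => j /eqP; rewrite ?eq_ord //=; [move/eqP/val_inj <- |
      move=> /eqP E; have := ltn_ord i; rewrite E ltnNge leq_addr].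
  case: splitP => j /= => [E|/eqP]; first by have := ltn_ord j; rewrite -E ltnNge leq_addr.
  by rewrite eqn_add2l => /eqP/val_inj <-.
- move=> k x /asboolP[n [c [a [Aa ->]]]]; apply/asboolP.
  exists n, (fun i => k * c i), a; split=> //.
  by rewrite scaler_sumr; apply: eq_bigr => i _; rewrite scalerA.
Qed.

HB.instance Definition _ A :=
  GRing.isSubmodClosed.Build R V (spanb A) (spanb_closed A).

Definition span (A : V -> Prop) : submodClosed V := spanb A.

Lemma span_sub (A : V -> Prop) S :
  (forall x, A x -> x \in S) -> forall x, x \in span A -> x \in S.
Proof.
move=> AS x /asboolP[n [c [a [Aa ->]]]].
by apply: rpred_sum => i _; apply: rpredZ; apply: AS.
Qed.

Lemma mem_span (A : V -> Prop) x : A x -> x \in span A.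
Proof.
move=> Ax; apply/asboolP; exists 1%N, (fun=> 1), (fun=> x).
by rewrite big_ord1 scale1r.
Qed.

Section Quotient.
Variable S : submodClosed V.

Lemma submod_oppr x : x \in S -> - x \in S.
Proof. by move=> xS; rewrite -scaleN1r rpredZ. Qed.

Definition eqmod : rel V := fun x y => x - y \in S.

Lemma eqmod_equiv : equiv_class_of eqmod.
Proof.
split=> [x|x y|y x z]; rewrite /eqmod ?subrr ?rpred0 //.
  by apply/idP/idP => /submod_oppr; rewrite opprB.
by move=> ? ?; rewrite -[x](addrNK y) -addrA rpredD.
Qed.

Canonical eqmod_equivRel := EquivRelPack eqmod_equiv.
Canonical eqmod_encModRel := defaultEncModRel eqmod.

Definition quotmod := {eq_quot eqmod}.
HB.instance Definition _ : EqQuotient V eqmod quotmod := EqQuotient.on quotmod.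
HB.instance Definition _ := Choice.on quotmod.

Lemma eqmodE x y : (x - y \in S) = (x == y %[mod quotmod]).
Proof. by rewrite piE. Qed.

Definition quotmod_zero : quotmod := lift_cst quotmod 0.
Definition quotmod_add := lift_op2 quotmod +%R.
Definition quotmod_opp := lift_op1 quotmod -%R.
Definition quotmod_scale (a : R) := lift_op1 quotmod ( *:%R a).

Canonical pi_quotmod_zero := PiConst quotmod_zero.

Lemma pi_quotmod_opp : {morph \pi : x / - x >-> quotmod_opp x}.
Proof.
move=> x; unlock quotmod_opp; apply/eqP; rewrite piE /eqmod.
by rewrite -opprD submod_oppr // eqmodE reprK.
Qed.
Canonical pi_quotmod_opp_morph := PiMorph1 pi_quotmod_opp.

Lemma pi_quotmod_add : {morph \pi : x y / x + y >-> quotmod_add x y}.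
Proof.
move=> x y; unlock quotmod_add; apply/eqP; rewrite piE /eqmod.
by rewrite opprD addrACA rpredD // eqmodE reprK.
Qed.
Canonical pi_quotmod_add_morph := PiMorph2 pi_quotmod_add.

Lemma pi_quotmod_scale a : {morph \pi : x / a *: x >-> quotmod_scale a x}.
Proof.
move=> x; unlock quotmod_scale; apply/eqP; rewrite piE /eqmod.
by rewrite -scalerBr rpredZ // eqmodE reprK.
Qed.
Canonical pi_quotmod_scale_morph a := PiMorph1 (pi_quotmod_scale a).

Lemma quotmod_addA : associative quotmod_add.
Proof. by move=> x y z; rewrite -[x]reprK -[y]reprK -[z]reprK !piE addrA. Qed.
Lemma quotmod_addC : commutative quotmod_add.
Proof. by move=> x y; rewrite -[x]reprK -[y]reprK !piE addrC. Qed.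
Lemma quotmod_add0 : left_id quotmod_zero quotmod_add.
Proof. by move=> x; rewrite -[x]reprK !piE add0r. Qed.
Lemma quotmod_addN : left_inverse quotmod_zero quotmod_opp quotmod_add.
Proof. by move=> x; rewrite -[x]reprK !piE addNr. Qed.

HB.instance Definition _ := GRing.isZmodule.Build quotmod
  quotmod_addA quotmod_addC quotmod_add0 quotmod_addN.

Lemma quotmod_scaleA a b x :
  quotmod_scale a (quotmod_scale b x) = quotmod_scale (a * b) x.
Proof. by rewrite -[x]reprK !piE scalerA. Qed.
Lemma quotmod_scale1 : left_id 1 quotmod_scale.
Proof. by move=> x; rewrite -[x]reprK !piE scale1r. Qed.
Lemma quotmod_scaleDr : right_distributive quotmod_scale +%R.
Proof.
by move=> a x y; rewrite -[x]reprK -[y]reprK /GRing.add /= !piE scalerDr.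
Qed.
Lemma quotmod_scaleDl x : {morph quotmod_scale^~ x : a b / a + b}.
Proof.
by move=> a b; rewrite -[x]reprK [X in _ = X]/GRing.add /= !piE scalerDl.
Qed.

HB.instance Definition _ := GRing.Zmodule_isLmodule.Build R quotmod
  quotmod_scaleA quotmod_scale1 quotmod_scaleDr quotmod_scaleDl.

Definition quot_pi (x : V) : quotmod := \pi x.

Lemma quot_pi_linear : linear quot_pi.
Proof.
by move=> a x y; rewrite /quot_pi /GRing.add /= /GRing.scale /= !piE.
Qed.
HB.instance Definition _ :=
  GRing.isLinear.Build R V quotmod _ quot_pi quot_pi_linear.

Lemma quot_pi_repr q : quot_pi (repr q) = q.
Proof. exact: reprK. Qed.

Lemma quot_pi_eq0 x : (quot_pi x == 0) = (x \in S).
Proof. by rewrite -(raddf0 quot_pi) -eqmodE subr0. Qed.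

End Quotient.
End Submodule.

Section QuotientMap.
Variables (R : comNzRingType) (U V : lmodType R).
Variables (S : submodClosed U) (T : submodClosed V) (f : {linear U -> V}).
Hypothesis fST : forall x, x \in S -> f x \in T.

Definition quot_map_fun (q : quotmod S) : quotmod T := quot_pi T (f (repr q)).

Lemma quot_map_funE x : quot_map_fun (quot_pi S x) = quot_pi T (f x).
Proof.
apply/eqP; rewrite -subr_eq0 -linearB quot_pi_eq0 -linearB; apply: fST.
by rewrite -quot_pi_eq0 linearB subr_eq0 /= quot_pi_repr.
Qed.

Lemma quot_map_linear : linear quot_map_fun.
Proof.
move=> a x y.
rewrite -[x]quot_pi_repr -[y]quot_pi_repr -linearP !quot_map_funE.
by rewrite !linearP.
Qed.
HB.instance Definition _ := GRing.isLinear.Build R (quotmod S) (quotmod T) _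
  quot_map_fun quot_map_linear.

Definition quot_map : {linear quotmod S -> quotmod T} := quot_map_fun.

Lemma quot_mapE x : quot_map (quot_pi S x) = quot_pi T (f x).
Proof. exact: quot_map_funE. Qed.

End QuotientMap.

Section Inclusion.
Variables (R : comNzRingType) (V : lmodType R) (S T : submodClosed V).
Hypothesis sST : forall x, x \in S -> x \in T.

Definition submod_incl_fun (x : submod S) : submod T := Submod (sST (valP x)).

Lemma submod_incl_linear : linear submod_incl_fun.
Proof. by move=> a x y; apply: val_inj. Qed.
HB.instance Definition _ := GRing.isLinear.Build R (submod S) (submod T) _
  submod_incl_fun submod_incl_linear.

Definition submod_incl : {linear submod S -> submod T} := submod_incl_fun.

End Inclusion.

Section KernelImage.
Variables (R : comNzRingType) (U V : lmodType R) (f : {linear U -> V}).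

Definition kerb : {pred U} := fun x => f x == 0.

Lemma kerb_closed : subsemimod_closed kerb.
Proof.
split; [split=> [|x y]|move=> a x]; rewrite /kerb !unfold_in ?linear0 //.
  by rewrite linearD => /eqP-> /eqP->; rewrite addr0.
by rewrite linearZ => /eqP-> /=; rewrite scaler0.
Qed.
HB.instance Definition _ := GRing.isSubmodClosed.Build R U kerb kerb_closed.

Definition lin_ker : submodClosed U := kerb.

Definition imb : {pred V} := fun y => `[< exists x, y = f x >].

Lemma imb_closed : subsemimod_closed imb.
Proof.
split; [split=> [|x y /asboolP[u ->] /asboolP[v ->]]|move=> a x /asboolP[u ->]];
  apply/asboolP; first by exists 0; rewrite linear0.
- by exists (u + v); rewrite linearD.
- by exists (a *: u); rewrite linearZ.
Qed.
HB.instance Definition _ := GRing.isSubmodClosed.Build R V imb imb_closed.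

Definition lin_im : submodClosed V := imb.

End KernelImage.

(* S seen as a submodule of the module T; S is not required to lie in T, the
   result being the intersection of S and T. *)
Section Relative.
Variables (R : comNzRingType) (V : lmodType R) (T S : submodClosed V).

Definition relb : {pred submod T} := fun x => submod_val x \in S.

Lemma relb_closed : subsemimod_closed relb.
Proof.
split; [split=> [|x y]|move=> a x]; rewrite /relb !unfold_in.
- exact: (rpred0 S).
- exact: (@rpredD _ S).
- exact: (@rpredZ _ _ S).
Qed.
HB.instance Definition _ :=
  GRing.isSubmodClosed.Build R (submod T) relb relb_closed.

Definition rel_submod : submodClosed (submod T) := relb.

End Relative.

Section Hom.
Variables (R : comNzRingType) (U V : lmodType R).
Local Notation Hom := {linear U -> V}.

HB.instance Definition _ := gen_eqMixin Hom.
HB.instance Definition _ := gen_choiceMixin Hom.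


Lemma hom_ext (f g : Hom) : f =1 g -> f = g.
Proof.
case: f g => [f cf] [g cg] /= /funext E; subst g; congr GRing.Linear.Pack.
by case: cf cg => [[p] [q]] [[r] [s]]; rewrite (Prop_irrelevance p r)
  (Prop_irrelevance q s).
Qed.

Definition hom0 : Hom := \0%R.
Definition hom_add (f g : Hom) : Hom := f \+ g.
Definition hom_opp (f : Hom) : Hom := \- f.
Definition hom_scale (a : R) (f : Hom) : Hom := a \*: f.

Lemma hom_addA : associative hom_add.
Proof. by move=> f g h; apply: hom_ext => x /=; rewrite addrA. Qed.
Lemma hom_addC : commutative hom_add.
Proof. by move=> f g; apply: hom_ext => x /=; rewrite addrC. Qed.
Lemma hom_add0 : left_id hom0 hom_add.
Proof. by move=> f; apply: hom_ext => x /=; rewrite add0r. Qed.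
Lemma hom_addN : left_inverse hom0 hom_opp hom_add.
Proof. by move=> f; apply: hom_ext => x /=; rewrite addNr. Qed.
HB.instance Definition _ :=
  GRing.isZmodule.Build Hom hom_addA hom_addC hom_add0 hom_addN.

Lemma hom_scaleA a b f : hom_scale a (hom_scale b f) = hom_scale (a * b) f.
Proof. by apply: hom_ext => x /=; rewrite scalerA. Qed.
Lemma hom_scale1 : left_id 1 hom_scale.
Proof. by move=> f; apply: hom_ext => x /=; rewrite scale1r. Qed.
Lemma hom_scaleDr : right_distributive hom_scale +%R.
Proof. by move=> a f g; apply: hom_ext => x /=; rewrite scalerDr. Qed.
Lemma hom_scaleDl f : {morph hom_scale^~ f : a b / a + b}.
Proof. by move=> a b; apply: hom_ext => x /=; rewrite scalerDl. Qed.
HB.instance Definition _ := GRing.Zmodule_isLmodule.Build R Hom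
  hom_scaleA hom_scale1 hom_scaleDr hom_scaleDl.

End Hom.

Section HomComposition.
Variables (R : comNzRingType) (U V W : lmodType R).

Definition hom_comp (g : {linear V -> W}) (f : {linear U -> V}) :
  {linear U -> W} := g \o f.

Definition postcomp_fun (g : {linear V -> W}) (f : {linear U -> V}) :=
  hom_comp g f.
Lemma postcomp_linear g : linear (postcomp_fun g).
Proof. by move=> a f f'; apply: hom_ext => x /=; rewrite linearP. Qed.
HB.instance Definition _ g := GRing.isLinear.Build R
  {linear U -> V} {linear U -> W} _ (postcomp_fun g) (postcomp_linear g).
Definition postcomp g : {linear {linear U -> V} -> {linear U -> W}} :=
  postcomp_fun g.

Definition precomp_fun (f : {linear U -> V}) (g : {linear V -> W}) :=
  hom_comp g f.
Lemma precomp_linear f : linear (precomp_fun f).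
Proof. by move=> a g g'; apply: hom_ext. Qed.
HB.instance Definition _ f := GRing.isLinear.Build R
  {linear V -> W} {linear U -> W} _ (precomp_fun f) (precomp_linear f).
Definition precomp f : {linear {linear V -> W} -> {linear U -> W}} :=
  precomp_fun f.

End HomComposition.

Definition hom_id (R : comNzRingType) (U : lmodType R) : {linear U -> U} := idfun.

Section DirectSum.
Variables (R : comNzRingType) (A : nat -> lmodType R).

Definition dprod := forall n, A n.
HB.instance Definition _ := Choice.on dprod.

Implicit Types x y z : dprod.
Definition dprod0 : dprod := fun=> 0.
Definition dprod_add x y : dprod := fun n => x n + y n.
Definition dprod_opp x : dprod := fun n => - x n.
Definition dprod_scale (a : R) x : dprod := fun n => a *: x n.

Lemma dprod_ext x y : (forall n, x n = y n) -> x = y.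
Proof. exact: functional_extensionality_dep. Qed.

Lemma dprod_addA : associative dprod_add.
Proof. by move=> x y z; apply: dprod_ext => n; exact: addrA. Qed.
Lemma dprod_addC : commutative dprod_add.
Proof. by move=> x y; apply: dprod_ext => n; exact: addrC. Qed.
Lemma dprod_add0 : left_id dprod0 dprod_add.
Proof. by move=> x; apply: dprod_ext => n; exact: add0r. Qed.
Lemma dprod_addN : left_inverse dprod0 dprod_opp dprod_add.
Proof. by move=> x; apply: dprod_ext => n; exact: addNr. Qed.
HB.instance Definition _ := GRing.isZmodule.Build dprod
  dprod_addA dprod_addC dprod_add0 dprod_addN.

Lemma dprod_scaleA a b x :
  dprod_scale a (dprod_scale b x) = dprod_scale (a * b) x.
Proof. by apply: dprod_ext => n; exact: scalerA. Qed.
Lemma dprod_scale1 : left_id 1 dprod_scale.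
Proof. by move=> x; apply: dprod_ext => n; exact: scale1r. Qed.
Lemma dprod_scaleDr : right_distributive dprod_scale +%R.
Proof. by move=> a x y; apply: dprod_ext => n; exact: scalerDr. Qed.
Lemma dprod_scaleDl x : {morph dprod_scale^~ x : a b / a + b}.
Proof. by move=> a b; apply: dprod_ext => n; exact: scalerDl. Qed.
HB.instance Definition _ := GRing.Zmodule_isLmodule.Build R dprod
  dprod_scaleA dprod_scale1 dprod_scaleDr dprod_scaleDl.

Definition finsuppb : {pred dprod} := fun x =>
  `[< exists n, forall m, (n <= m)%N -> x m = 0 >].

Lemma finsuppb_closed : subsemimod_closed finsuppb.
Proof.
split; [split=> [|x y /asboolP[n xn] /asboolP[m ym]]|
        move=> a x /asboolP[n xn]]; apply/asboolP.
- by exists 0%N.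
- exists (maxn n m) => k; rewrite geq_max => /andP[nk mk].
  by rewrite -[LHS]/(x k + y k) xn // ym // addr0.
- by exists n => k nk; rewrite -[LHS]/(a *: x k) xn // scaler0.
Qed.
HB.instance Definition _ :=
  GRing.isSubmodClosed.Build R dprod finsuppb finsuppb_closed.

Definition finsupp : submodClosed dprod := finsuppb.
Definition dsum := submod finsupp.
HB.instance Definition _ := GRing.Lmodule.on dsum.

Definition dprod_single n (a : A n) : dprod := dfwith (fun i => 0 : A i) a.

Lemma dprod_single_finsupp n (a : A n) : dprod_single a \in finsupp.
Proof.
apply/asboolP; exists n.+1 => m nm; rewrite /dprod_single dfwith_out //.
by rewrite neq_ltn nm.
Qed.

Definition dsum_in n (a : A n) : dsum := Submod (dprod_single_finsupp a).

End DirectSum.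

Record dirsys (R : comNzRingType) := Dirsys {
  dsobj :> nat -> lmodType R;
  dsmap : forall i j, (i <= j)%N -> {linear dsobj i -> dsobj j};
  dsmap_id : forall i (h : (i <= i)%N) x, dsmap h x = x;
  dsmap_comp : forall i j k (hij : (i <= j)%N) (hjk : (j <= k)%N)
      (hik : (i <= k)%N) x, dsmap hjk (dsmap hij x) = dsmap hik x
}.

Arguments dsmap {R d i j} h.

(* The direct limit of the A_n as the quotient of the direct sum of the A_n by the submodule
   generated by the elements a - phi_ij(a), for i <= j and a in A_i. *)
Section Colimit.
Variables (R : comNzRingType) (A : dirsys R).

Definition colim_rel : submodClosed (dsum A) := span (fun x =>
  exists i j (h : (i <= j)%N) (a : A i), x = dsum_in a - dsum_in (dsmap h a)).

Definition colim := quotmod colim_rel.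
HB.instance Definition _ := GRing.Lmodule.on colim.

Definition colim_in i (a : A i) : colim := quot_pi colim_rel (dsum_in a).

End Colimit.

Section ColimitMap.
Variables (R : comNzRingType) (A B : dirsys R).
Variable f : forall i, {linear A i -> B i}.
Hypothesis f_nat :
  forall i j (h : (i <= j)%N) a, f j (dsmap h a) = dsmap h (f i a).

Definition dprod_map (x : dprod A) : dprod B := fun n => f n (x n).

Lemma dprod_map_finsupp (x : dsum A) : dprod_map (\val x) \in finsupp B.
Proof.
case: x => x /= /asboolP[n xn]; apply/asboolP; exists n => m nm.
by rewrite /dprod_map xn // linear0.
Qed.

Definition dsum_map_fun (x : dsum A) : dsum B := Submod (dprod_map_finsupp x).
Lemma dsum_map_linear : linear dsum_map_fun.
Proof.
move=> a x y; apply: val_inj; apply: dprod_ext => n.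
exact: (linearP (f n)).
Qed.
HB.instance Definition _ := GRing.isLinear.Build R (dsum A) (dsum B) _
  dsum_map_fun dsum_map_linear.
Definition dsum_map : {linear dsum A -> dsum B} := dsum_map_fun.

Lemma dsum_map_in i (a : A i) : dsum_map (dsum_in a) = dsum_in (f i a).
Proof.
apply: val_inj; apply: dprod_ext => n /=; rewrite /dprod_map /dprod_single.
have [<-|ni] := eqVneq i n; first by rewrite !dfwith_in.
by rewrite !dfwith_out // linear0.
Qed.

Lemma dsum_map_rel x : x \in colim_rel A -> dsum_map x \in colim_rel B.
Proof.
move=> /asboolP[n [c [a [Aa ->]]]]; apply/asboolP.
exists n, c, (fun i => dsum_map (a i)); split=> [i|].
  have [k [j [h [b ->]]]] := Aa i; exists k, j, h, (f k b).
  by rewrite linearB !dsum_map_in f_nat.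
by rewrite linear_sum; apply: eq_bigr => i _; rewrite linearZ.
Qed.

Definition colim_map : {linear colim A -> colim B} := quot_map dsum_map_rel.

End ColimitMap.

Record additive_functor (R : comNzRingType) := Functor {
  fobj :> lmodType R -> lmodType R;
  fmap : forall A B : lmodType R, {linear A -> B} -> {linear fobj A -> fobj B};
  fmap_id : forall A, fmap (hom_id A) =1 id;
  fmap_comp : forall (A B C : lmodType R) (g : {linear B -> C}) (f : {linear A -> B}),
    fmap (hom_comp g f) =1 fmap g \o fmap f;
  fmap_add : forall (A B : lmodType R) (f g : {linear A -> B}),
    fmap (hom_add f g) =1 fmap f \+ fmap g
}.

Definition injective_module (R : comNzRingType) (E : lmodType R) : Prop :=
  forall (A B : lmodType R) (i : {linear A -> B}) (f : {linear A -> E}),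
    injective i -> exists g : {linear B -> E}, forall x, g (i x) = f x.

Record injective_resolution (R : comNzRingType) (N : lmodType R) := InjRes {
  iobj :> nat -> lmodType R;
  iaug : {linear N -> iobj 0%N};
  idiff : forall n, {linear iobj n -> iobj n.+1};
  iobj_inj : forall n, injective_module (iobj n);
  iaug_inj : injective iaug;
  iexact0 : forall x, idiff 0%N x = 0 <-> exists y, x = iaug y;
  iexactS : forall n x, idiff n.+1 x = 0 <-> exists y, x = idiff n y
}.

(* ker g / im f; rel_submod makes it total, so g \o f = 0 need not be given. *)
Definition homology (R : comNzRingType) (U V W : lmodType R)
    (f : {linear U -> V}) (g : {linear V -> W}) : lmodType R :=
  quotmod (rel_submod (lin_ker g) (lin_im f)).

(* R^i F (N), computed as the i-th cohomology of 0 -> F E^0 -> F E^1 -> ... for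
   an injective resolution E of N; up to isomorphism it does not depend on E.
   In degree 0 the incoming map is zero, so its source is immaterial. *)
Definition right_derived (R : comNzRingType) (F : additive_functor R) (N : lmodType R)
    (E : injective_resolution N) (i : nat) : lmodType R :=
  match i with
  | 0 => homology (hom0 (F N) (F (E 0%N))) (fmap F (idiff E 0))
  | j.+1 => homology (fmap F (idiff E j)) (fmap F (idiff E j.+1))
  end.

Section IdealTransform.
Variables (R : comNzRingType) (I : submodClosed R^o) (M : lmodType R).

Definition ideal_pow (n : nat) : submodClosed R^o :=
  span (fun x : R^o => exists a : 'I_n -> R,
    (forall i, a i \in I) /\ x = \prod_(i < n) a i).

Definition ideal_powM (n : nat) : submodClosed M :=
  span (fun x : M => exists (a : R) (m : M), a \in ideal_pow n /\ x = a *: m).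

Lemma ideal_pow_anti i j : (i <= j)%N ->
  forall x, x \in ideal_pow j -> x \in ideal_pow i.
Proof.
move=> /subnKC <-; apply: span_sub => x [a [aI ->]].
rewrite big_split_ord /= mulrC; apply: (@rpredZ _ R^o (ideal_pow i)).
by apply: mem_span; exists (fun k => a (lshift _ k)); split.
Qed.

Lemma ideal_powM_anti i j : (i <= j)%N ->
  forall x, x \in ideal_powM j -> x \in ideal_powM i.
Proof.
move=> ij; apply: span_sub => x [a [m [aI ->]]]; apply: mem_span.
by exists a, m; split=> //; apply: ideal_pow_anti aI.
Qed.

Definition hom_powM (N : lmodType R) (n : nat) : lmodType R :=
  {linear submod (ideal_powM n) -> N}.

Definition restr (N : lmodType R) i j (h : (i <= j)%N) :
    {linear hom_powM N i -> hom_powM N j} :=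
  precomp N (submod_incl (ideal_powM_anti h)).

Lemma restr_id N i (h : (i <= i)%N) f : restr N h f = f.
Proof.
by apply: hom_ext => x /=; congr (f _); apply: val_inj.
Qed.

Lemma restr_comp N i j k (hij : (i <= j)%N) (hjk : (j <= k)%N)
  (hik : (i <= k)%N) f : restr N hjk (restr N hij f) = restr N hik f.
Proof.
by apply: hom_ext => x /=; congr (f _); apply: val_inj.
Qed.

Definition hom_powM_sys (N : lmodType R) : dirsys R :=
  Dirsys (@restr_id N) (@restr_comp N).

Definition DI_obj (N : lmodType R) : lmodType R := colim (hom_powM_sys N).

Definition hom_powM_map (A B : lmodType R) (g : {linear A -> B}) n :
    {linear hom_powM_sys A n -> hom_powM_sys B n} := postcomp _ g.

Lemma hom_powM_map_nat (A B : lmodType R) (g : {linear A -> B})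
    i j (h : (i <= j)%N) (f : hom_powM_sys A i) :
  hom_powM_map g j (dsmap h f) = dsmap h (hom_powM_map g i f).
Proof. exact: hom_ext. Qed.

Definition DI_map (A B : lmodType R) (g : {linear A -> B}) :
    {linear DI_obj A -> DI_obj B} :=
  colim_map (hom_powM_map_nat g).

Lemma DI_map_id A : DI_map (hom_id A) =1 id.
Proof.
move=> q; rewrite -[q]quot_pi_repr [LHS]quot_mapE; congr quot_pi.
by apply: val_inj; apply: dprod_ext => n; apply: hom_ext.
Qed.

Lemma DI_map_comp (A B C : lmodType R) (g : {linear B -> C})
    (f : {linear A -> B}) : DI_map (hom_comp g f) =1 DI_map g \o DI_map f.
Proof.
move=> q; rewrite -[q]quot_pi_repr -[RHS]/(DI_map g (DI_map f _)).
rewrite [DI_map f _]quot_mapE [RHS]quot_mapE [LHS]quot_mapE; congr quot_pi.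
by apply: val_inj; apply: dprod_ext => n; apply: hom_ext.
Qed.

Lemma DI_map_add (A B : lmodType R) (f g : {linear A -> B}) :
  DI_map (hom_add f g) =1 DI_map f \+ DI_map g.
Proof.
move=> q; rewrite -[q]quot_pi_repr -[RHS]/(DI_map f _ + DI_map g _).
rewrite [DI_map f _]quot_mapE [DI_map g _]quot_mapE [LHS]quot_mapE -linearD.
congr quot_pi.
by apply: val_inj; apply: dprod_ext => n; apply: hom_ext.
Qed.

(* The functor D_I(M, -) = lim_n Hom(I^n M, -), with I^0 M = M. *)
Definition ideal_transform : additive_functor R :=
  Functor DI_map_id DI_map_comp DI_map_add.

End IdealTransform.

Definition fin_gen (R : comNzRingType) (M : lmodType R) : Prop :=
  exists n (g : 'I_n -> M), forall x, exists c : 'I_n -> R,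
    x = \sum_(i < n) c i *: g i.

Definition noetherian (R : comNzRingType) : Prop :=
  forall J : submodClosed R^o, fin_gen (submod J).

(* Main.v *)
(* Let D be the differential of the (total, ungraded) Koszul complex of a finite
   set s of generators of I, and let C^j = D_I(M, E^j). Each C^j is Koszul
   acyclic: for E injective, extending a Koszul cocycle of Hom(I^n M, E) to a
   coboundary after restriction to I^(n+k) M only requires that the part of
   ker D^T lying over I^(n+k) M is contained in im D^T. As s annihilates Koszul
   homology, this follows from a weak form of the Artin-Rees lemma.
   With Z^j and B^j the cycles and boundaries of C, the exact sequences
   0 -> B^j -> Z^j -> H^j -> 0 and 0 -> Z^j -> C^j -> B^(j+1) -> 0 show
   by induction that B^j has finitely generated Koszul cohomology for j <= t.
   Finally Hom(R/I, H^t), the part of H^t killed by I, embeds into the Koszul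
   cohomology of B^t, because no nonzero element of C^t is killed by I. *)

From HB Require Import structures.
Require Import Defs.
From mathcomp Require Import all_boot all_algebra.
From mathcomp Require Import boolp.

Set Implicit Arguments.
Unset Strict Implicit.
Unset Printing Implicit Defensive.

Import GRing.Theory.
Local Open Scope ring_scope.

(** * Finite generation modulo a submodule *)

Section PropSubmodule.
Variables (R : comNzRingType) (V : lmodType R).

(** [Prop]-valued rather than packed as [submodClosed], so that sums, images, cocycle conditions and
    relations can be used directly as submodules. *)
Definition submodule (P : V -> Prop) : Prop :=
  P 0 /\ forall (a : R) x y, P x -> P y -> P (a *: x + y).

Section Closure.
Variable P : V -> Prop.
Hypothesis subP : submodule P.

Lemma submodule0 : P 0. Proof. exact: subP.1. Qed.

Lemma submoduleP a x y : P x -> P y -> P (a *: x + y).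
Proof. exact: subP.2. Qed.

Lemma submoduleD x y : P x -> P y -> P (x + y).
Proof. by move=> Px Py; rewrite -[x]scale1r; apply: submoduleP. Qed.

Lemma submoduleZ a x : P x -> P (a *: x).
Proof. by move=> Px; rewrite -[_ *: _]addr0; apply/submoduleP/submodule0. Qed.

Lemma submoduleB x y : P x -> P y -> P (x - y).
Proof. by move=> Px Py; rewrite addrC -scaleN1r; apply: submoduleP. Qed.

Lemma submodule_sum (J : Type) (r : seq J) (F : J -> V) :
  (forall i, P (F i)) -> P (\sum_(i <- r) F i).
Proof.
move=> PF; elim: r => [|i r IH]; first by rewrite big_nil; apply: submodule0.
by rewrite big_cons; apply: submoduleD.
Qed.

End Closure.

Lemma submodule_mem (S : submodClosed V) : submodule (fun x => x \in S).
Proof. by split=> [|a x y xS yS]; rewrite ?rpred0 // rpredD ?rpredZ. Qed.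

Lemma submoduleI (P Q : V -> Prop) :
  submodule P -> submodule Q -> submodule (fun x => P x /\ Q x).
Proof.
move=> [P0 PP] [Q0 QP]; split=> // a x y [Px Qx] [Py Qy].
by split; [apply: PP | apply: QP].
Qed.

Definition addsub (P Q : V -> Prop) (x : V) : Prop := exists y, P y /\ Q (x - y).

Lemma addsub_submodule P Q : submodule P -> submodule Q -> submodule (addsub P Q).
Proof.
move=> [P0 PP] [Q0 QP]; split; first by exists 0; rewrite subr0.
move=> a x x' [y [Py Qxy]] [y' [Py' Qxy']]; exists (a *: y + y').
by rewrite opprD addrACA -scalerBr; split; [apply: PP | apply: QP].
Qed.

(** The recursion on the list lets inductions split off one generator at a time. *)
Fixpoint lspan (s : seq V) (y : V) : Prop :=
  if s is g :: s' then exists r : R, lspan s' (y - r *: g) else y = 0.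

Lemma lspan_submodule s : submodule (lspan s).
Proof.
elim: s => [|g s [IH0 IHP]] /=.
  by split=> // a x y -> ->; rewrite scaler0 addr0.
split; first by exists 0; rewrite scale0r subr0.
move=> a x y [r rx] [q qy]; exists (a * r + q).
rewrite scalerDl opprD addrACA -scalerA -scalerBr; exact: IHP.
Qed.

Lemma lspan_cat s1 s2 y1 y2 :
  lspan s1 y1 -> lspan s2 y2 -> lspan (s1 ++ s2) (y1 + y2).
Proof.
elim: s1 y1 => [|g s IH] y1 /=; first by move=> ->; rewrite add0r.
by move=> [r sy] sy2; exists r; rewrite addrAC; apply: IH.
Qed.

Lemma lspan_in s P : submodule P -> {in s, forall x, P x} ->
  forall y, lspan s y -> P y.
Proof.
move=> subP; elim: s => [|g s IH] /= sP y; first by move=> ->; apply: submodule0.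
move=> [r sy]; rewrite -[y](subrK (r *: g)); apply: submoduleD => //.
  by apply: IH sy => x xs; apply: sP; rewrite inE xs orbT.
by apply: submoduleZ => //; apply: sP; rewrite mem_head.
Qed.

Lemma lspan_mem s x : x \in s -> lspan s x.
Proof.
elim: s => //= h s IH; rewrite inE => /predU1P[->|xs].
  by exists 1; rewrite scale1r subrr; apply: (lspan_submodule s).1.
by exists 0; rewrite scale0r subr0; apply: IH.
Qed.

Lemma lspan_nth s y : lspan s y <->
  exists c : nat -> R, y = \sum_(i < size s) c i *: s`_i.
Proof.
elim: s y => [|g s IH] y /=.
  split=> [->|[c ->]]; last by rewrite big_ord0.
  by exists (fun=> 0); rewrite big_ord0.
split=> [[r /IH[c E]]|[c ->]].
  exists (fun i => if i is j.+1 then c j else r).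
  by rewrite big_ord_recl /= -E addrC subrK.
exists (c 0%N); apply/IH; exists (fun i => c i.+1).
by rewrite big_ord_recl /= addrC addKr.
Qed.

(* S is finitely generated modulo T; neither inclusion between S and T is
   required. *)
Definition fg (S T : V -> Prop) : Prop :=
  exists s : seq V, {in s, forall x, S x} /\
    forall x, S x -> addsub (lspan s) T x.

(** Subtracting a combination of the first generators brings an element of [P] into [Q] as well,
    where the second list takes over. *)
Lemma fg_trans (P Q T : V -> Prop) : submodule P ->
  fg P Q -> fg (fun x => P x /\ Q x) T -> fg P T.
Proof.
move=> subP [s [sP sQ]] [s' [s'P s'T]]; exists (s ++ s'); split=> [x|x Px].
  by rewrite mem_cat => /orP[/sP|/s'P[]].
have [y [sy Qy]] := sQ x Px.
have Pxy : P (x - y) by apply: submoduleB => //; apply: lspan_in sy.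
have [y' [sy' Ty']] := s'T _ (conj Pxy Qy).
by exists (y + y'); split; [apply: lspan_cat | rewrite opprD addrA].
Qed.

Lemma fg_sub0 (P Q : V -> Prop) : (forall x, P x -> Q x) -> fg P Q.
Proof. by move=> PQ; exists [::]; split=> // x /PQ; exists 0; rewrite subr0. Qed.

End PropSubmodule.

Arguments submodule {R V} P.

Lemma fin_gen_seq (R : comNzRingType) (M : lmodType R) :
  fin_gen M <-> exists s : seq M, forall x, lspan s x.
Proof.
split=> [[n [g gM]]|[s sM]].
  exists (codom g) => x; have [c ->] := gM x.
  apply: submodule_sum => [|i]; first exact: lspan_submodule.
  apply: submoduleZ; first exact: lspan_submodule.
  exact/lspan_mem/codom_f.
exists (size s), (fun i : 'I_(size s) => s`_i) => x.
by have /lspan_nth[c ->] := sM x; exists (fun i => c i).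
Qed.

Lemma span_ind (R : comNzRingType) (V : lmodType R) (A P : V -> Prop) :
  submodule P -> (forall x, A x -> P x) -> forall x, x \in Defs.span A -> P x.
Proof.
move=> subP AP x /asboolP[n [c [a [Aa ->]]]].
by apply: submodule_sum => // i; apply: submoduleZ => //; apply: AP.
Qed.

(** [noetherian] speaks of boolean ideals; the span of [J] is one with the same elements as [J]. *)
Lemma noetherian_fg (R : comNzRingType) (J : R^o -> Prop) :
  noetherian R -> submodule J ->
  exists2 s : seq R^o, {in s, forall x, J x} & forall x, J x -> lspan s x.
Proof.
move=> noeR subJ.
have spanJ x : x \in Defs.span J -> J x by apply: span_ind.
have [n [g gJ]] := noeR (Defs.span J).
exists [seq submod_val (g i) | i : 'I_n].
  by move=> x /codomP[i ->]; apply/spanJ/valP.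
move=> x Jx; have [c E] := gJ (Submod (mem_span Jx)).
have {E}-> : x = \sum_(i < n) c i *: submod_val (g i).
  by rewrite -[x]/(\val (Submod (mem_span Jx))) E raddf_sum.
apply: submodule_sum => [|i]; first exact: lspan_submodule.
apply: submoduleZ; first exact: lspan_submodule.
by apply: lspan_mem; apply: (codom_f (fun i => submod_val (g i))).
Qed.

(** By induction on [s]: the coefficients at [g] of elements of [P] form an ideal, and lifts of its
    generators reduce [P] to the part lying in [lspan s] plus [T]. *)
Lemma fg_of_span (R : comNzRingType) (V : lmodType R) (P T : V -> Prop)
    (s : seq V) : noetherian R -> submodule P -> submodule T ->
  (forall x, P x -> addsub (lspan s) T x) -> fg P T.
Proof.
move=> noeR subP subT; elim: s P subP => [|g s IH] P subP Ps.
  by apply: fg_sub0 => x /Ps[y [/= ->]]; rewrite subr0.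
pose N := addsub (lspan s) T.
have subN : submodule N by apply: addsub_submodule => //; apply: lspan_submodule.
have rel_lin (a : R) p r p' r' : a *: p + p' - (a *: (r : R^o) + r') *: g =
    a *: (p - r *: g) + (p' - r' *: g).
  by rewrite scalerDl opprD addrACA -scalerA -scalerBr.
pose J (r : R^o) := exists p, P p /\ N (p - r *: g).
have subJ : submodule J.
  split; first by exists 0; rewrite scale0r subr0; split; apply: submodule0.
  move=> a r q [p [Pp Np]] [p' [Pp' Np']]; exists (a *: p + p').
  by rewrite rel_lin; split; apply: submoduleP.
have [u uJ Ju] := noetherian_fg noeR subJ.
have /choice[f fP] (r : R^o) : exists p, r \in u -> P p /\ N (p - r *: g).
  by have [/uJ[p Hp]|_] := boolP (r \in u); [exists p | exists 0].
apply: (@fg_trans _ _ P N) => //; last first.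
  by apply: IH => [|p []] //; apply: submoduleI.
exists [seq f r | r <- u]; split=> [p /mapP[r /fP[Pfr _] ->] //|x Px].
have [y [[r sy] Txy]] := Ps x Px.
have Nxr : N (x - r *: g) by exists (y - r *: g); rewrite opprB addrA subrK.
have [z [uz Nz]] : exists z, lspan [seq f r | r <- u] z /\ N (z - r *: g).
  have : lspan u (r : R^o) by apply: Ju; exists x.
  move: (r : R^o); apply: lspan_in => [|q qu].
    split; first exists 0.
      by rewrite scale0r subr0; split; [apply: (lspan_submodule _).1 | apply: submodule0].
    move=> a q q' [z [uz Nz]] [z' [uz' Nz']]; exists (a *: z + z').
    by rewrite rel_lin; split; [apply: (lspan_submodule _).2 | apply: submoduleP].
  by exists (f q); split; [apply/lspan_mem/map_f | have [] := fP q qu].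
exists z; split=> //; rewrite -[x](subrK (r *: g)) -addrA -[r *: g - z]opprB.
exact: submoduleB.
Qed.

(* A submodule rho of V * W is used in place of a linear map, since the
   correspondences between cocycles below are only defined up to a choice. *)
Lemma fg_rel (R : comNzRingType) (V W : lmodType R) (P Q : V -> Prop)
    (S T : W -> Prop) (rho : V -> W -> Prop) :
  noetherian R -> submodule P -> submodule S -> submodule T ->
  submodule (fun x : V * W => rho x.1 x.2) ->
  (forall p, P p -> exists w, rho p w /\ S w) ->
  (forall p w, P p -> rho p w -> T w -> Q p) ->
  fg S T -> fg P Q.
Proof.
move=> noeR subP subS subT subrho PS PQ [s [sS sT]].
(* The image of [P] in [S] is finitely generated modulo [T] because [R] is Noetherian; lifts of its
   generators generate [P] modulo [Q]. *)
pose S' w := S w /\ exists p, P p /\ rho p w.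
have subS' : submodule S'.
  apply: submoduleI => //; split.
    by exists 0; split; [apply: submodule0 | apply: subrho.1].
  move=> a w w' [p [Pp pw]] [p' [Pp' pw']]; exists (a *: p + p').
  by split; [apply: submoduleP | apply: (subrho.2 a (p, w) (p', w'))].
have [u [uS' S'u]] : fg S' T by apply: (fg_of_span (s := s)) => // w [/sT].
have /choice[f fP] w : exists p, w \in u -> P p /\ rho p w.
  by have [/uS'[_ [p Hp]]|_] := boolP (w \in u); [exists p | exists 0].
exists [seq f w | w <- u]; split=> [p /mapP[w /fP[Pfw _] ->] //|p Pp].
have [w [pw Sw]] := PS p Pp.
have [|w' [uw' Tww']] := S'u w; first by split=> //; exists p.
have [z [uz [Pz zw']]] : exists z, lspan [seq f r | r <- u] z /\ (P z /\ rho z w').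
  move: w' uw' {Tww'}; apply: lspan_in => [|q qu].
    split; first exists 0.
      split; first exact: (lspan_submodule _).1.
      by split; [apply: submodule0 | apply: subrho.1].
    move=> a q q' [z [uz [Pz zq]]] [z' [uz' [Pz' zq']]]; exists (a *: z + z').
    split; first by apply: (lspan_submodule _).2.
    by split; [apply: submoduleP | apply: (subrho.2 a (z, q) (z', q'))].
  by exists (f q); split; [apply/lspan_mem/map_f | apply: fP].
exists z; split=> //; apply: (PQ _ (w - w')) => //; first exact: submoduleB.
exact: (submoduleB subrho (x := (p, w)) (y := (z, w'))).
Qed.

Lemma fg_sub (R : comNzRingType) (V : lmodType R) (P S T : V -> Prop) :
  noetherian R -> submodule P -> submodule T ->
  (forall x, P x -> S x) -> fg S T -> fg P T.
Proof.
by move=> noeR subP subT PS [s [_ sT]]; apply: (fg_of_span (s := s)) => // x /PS/sT.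
Qed.

Lemma eq_fg (R : comNzRingType) (V : lmodType R) (S S' T T' : V -> Prop) :
  (forall x, S x <-> S' x) -> (forall x, T x <-> T' x) -> fg S T -> fg S' T'.
Proof.
move=> SS' TT' [s [sS sT]]; exists s; split=> [x /sS/SS' //|x /SS'/sT[y [sy /TT' Txy]]].
by exists y.
Qed.

(** * Koszul matrices and Koszul cohomology *)

Section MatrixAction.
Variables (R : comNzRingType) (V : lmodType R).

Definition mxact m n (A : 'M[R]_(m, n)) (x : {ffun 'I_n -> V}) : {ffun 'I_m -> V} :=
  [ffun i => \sum_j A i j *: x j].

Lemma mxact_linear m n (A : 'M[R]_(m, n)) : linear (mxact A).
Proof.
move=> a x y; apply/ffunP => i; rewrite !ffunE scaler_sumr -big_split /=.
by apply: eq_bigr => j _; rewrite !ffunE scalerDr !scalerA mulrC.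
Qed.
HB.instance Definition _ m n (A : 'M[R]_(m, n)) :=
  GRing.isLinear.Build R {ffun 'I_n -> V} {ffun 'I_m -> V} _ (mxact A) (mxact_linear A).

Lemma mxact_mul m n p (A : 'M[R]_(m, n)) (B : 'M[R]_(n, p)) x :
  mxact A (mxact B x) = mxact (A *m B) x.
Proof.
apply/ffunP => i; rewrite !ffunE.
under eq_bigr do rewrite ffunE scaler_sumr.
rewrite exchange_big /=; apply: eq_bigr => k _; rewrite mxE scaler_suml.
by apply: eq_bigr => j _; rewrite scalerA.
Qed.

Lemma mxactD m n (A B : 'M[R]_(m, n)) x : mxact (A + B) x = mxact A x + mxact B x.
Proof.
apply/ffunP => i; rewrite !ffunE -big_split /=.
by apply: eq_bigr => j _; rewrite mxE scalerDl.
Qed.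

Lemma mxact_scalar n (a : R) (x : {ffun 'I_n -> V}) : mxact a%:M x = a *: x.
Proof.
apply/ffunP => i; rewrite !ffunE (bigD1 i) //= mxE eqxx big1 ?addr0 // => j ji.
by rewrite mxE eq_sym (negPf ji) scale0r.
Qed.

Lemma mxact0 m n x : mxact (0 : 'M[R]_(m, n)) x = 0.
Proof. by apply/ffunP => i; rewrite !ffunE big1 // => j _; rewrite mxE scale0r. Qed.

Definition ffdelta n (i : 'I_n) (v : V) : {ffun 'I_n -> V} :=
  [ffun j => if j == i then v else 0].

Lemma ffdelta_linear n (i : 'I_n) : linear (ffdelta i).
Proof.
move=> a x y; apply/ffunP => j; rewrite !ffunE.
by case: eqP; rewrite // scaler0 addr0.
Qed.
HB.instance Definition _ n (i : 'I_n) :=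
  GRing.isLinear.Build R V {ffun 'I_n -> V} _ (ffdelta i) (ffdelta_linear i).

Lemma ffun_sum_delta n (x : {ffun 'I_n -> V}) : x = \sum_i ffdelta i (x i).
Proof.
apply/ffunP => j; rewrite sum_ffunE (bigD1 j) //= ffunE eqxx big1 ?addr0 // => i ij.
by rewrite ffunE eq_sym (negPf ij).
Qed.

Lemma mxact_delta m n (A : 'M[R]_(m, n)) j v i : mxact A (ffdelta j v) i = A i j *: v.
Proof.
rewrite ffunE (bigD1 j) //= ffunE eqxx big1 ?addr0 // => k kj.
by rewrite ffunE (negPf kj) scaler0.
Qed.

Definition pw n (S : V -> Prop) (x : {ffun 'I_n -> V}) : Prop := forall i, S (x i).

Lemma pw_zero n S : submodule S -> pw S (0 : {ffun 'I_n -> V}).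
Proof. by case=> S0 _ i; rewrite ffunE. Qed.

Lemma pw_comb n S (a : R) (x y : {ffun 'I_n -> V}) :
  submodule S -> pw S x -> pw S y -> pw S (a *: x + y).
Proof. by move=> [_ SP] Sx Sy i; rewrite !ffunE; apply: SP. Qed.

Lemma pwD n S (x y : {ffun 'I_n -> V}) :
  submodule S -> pw S x -> pw S y -> pw S (x + y).
Proof. by move=> subS Sx Sy i; rewrite ffunE; apply: submoduleD. Qed.

Lemma pw_submodule n S : submodule S -> submodule (@pw n S).
Proof. by move=> subS; split=> [|a x y]; [apply: pw_zero | apply: pw_comb]. Qed.

Lemma pw0 n (x : {ffun 'I_n -> V}) : pw (fun v => v = 0) x <-> x = 0.
Proof.
by split=> [x0|-> i]; [apply/ffunP => i; rewrite x0 ffunE | rewrite ffunE].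
Qed.

End MatrixAction.

Section MatrixActionMap.
Variables (R : comNzRingType) (V W : lmodType R) (d : {linear V -> W}).

Definition ffmap n (x : {ffun 'I_n -> V}) : {ffun 'I_n -> W} := [ffun i => d (x i)].

Lemma ffmap_linear n : linear (@ffmap n).
Proof. by move=> a x y; apply/ffunP => i; rewrite !ffunE linearP. Qed.
HB.instance Definition _ n := GRing.isLinear.Build R
  {ffun 'I_n -> V} {ffun 'I_n -> W} _ (@ffmap n) (@ffmap_linear n).

Lemma ffmap_mxact m n (A : 'M[R]_(m, n)) x : ffmap (mxact A x) = mxact A (ffmap x).
Proof.
apply/ffunP => i; rewrite !ffunE linear_sum; apply: eq_bigr => j _.
by rewrite linearZ ffunE.
Qed.

End MatrixActionMap.

Lemma submodule_preim (R : comNzRingType) (V W : lmodType R) (f : {linear V -> W}) P :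
  submodule P -> submodule (fun x => P (f x)).
Proof.
move=> [P0 PP]; split=> [|a x y Px Py]; first by rewrite linear0.
by rewrite linearP; apply: PP.
Qed.

Lemma submodule_zero (R : comNzRingType) (V : lmodType R) :
  submodule (fun x : V => x = 0).
Proof. by split=> // a x y -> ->; rewrite scaler0 addr0. Qed.

(* The total Koszul complex K(s), built as an iterated mapping cone: row 0 is
   the degree-0 summand and row k the degree-1 summand of the generator a. *)
Lemma koszul_matrix (R : comNzRingType) (s : seq R) :
  exists m (D : 'M[R]_m.+1), [/\ D *m D = 0,
    forall a, a \in s -> exists S, D *m S + S *m D = a%:M,
    forall j, D 0 j = 0,
    forall a, a \in s -> exists k, forall j, D k j = if j == 0 then a else 0 &
    forall k, D k 0 = 0 \/ D k 0 \in s].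
Proof.
elim: s => [|a s [m [D [DD DS D0 Dk DI]]]].
  exists 0%N, 0; split=> // [|j|k]; rewrite ?mul0mx ?mxE //; by left.
have E0 : (0 : 'I_(m.+1 + m.+1)) = lshift m.+1 0 by apply: val_inj.
have E0l (k : 'I_m.+1) : (lshift m.+1 k == lshift m.+1 0 :> 'I_(m + m.+1).+1) = (k == 0).
  by rewrite -!val_eqE.
have E0r (k : 'I_m.+1) : (rshift m.+1 k == lshift m.+1 0 :> 'I_(m + m.+1).+1) = false.
  by rewrite -!val_eqE.
(* The cone of multiplication by [a]; the sign of the second copy makes the off-diagonal block of
   the square cancel. *)
pose D' : 'M[R]_(m.+1 + m.+1) := block_mx D 0 a%:M (- D).
have shiftP (j : 'I_(m.+1 + m.+1)) :
    (exists k, j = lshift _ k) \/ (exists k, j = rshift _ k).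
  by rewrite -(splitK j); case: (split j) => k; [left | right]; exists k.
have D'ul k l : D' (lshift _ k) (lshift _ l) = D k l by rewrite block_mxEul.
have D'ur k l : D' (lshift _ k) (rshift _ l) = 0 by rewrite block_mxEur mxE.
have D'dl k l : D' (rshift _ k) (lshift _ l) = (a%:M : 'M_m.+1) k l.
  by rewrite block_mxEdl.
have D'dr k l : D' (rshift _ k) (rshift _ l) = - D k l.
  by rewrite block_mxEdr mxE.
exists (m + m.+1)%N, D'; split.
- transitivity (D' *m D'); first by [].
  rewrite mulmx_block !mulNmx !mulmxN !mulmx0 !mul0mx DD mul_mx_scalar mul_scalar_mx.
  by rewrite opprK oppr0 !addr0 ?add0r addrN block_mx0.
- move=> b; rewrite inE => /predU1P[->|/DS[S E]].
    (* The homotopy for the new generator identifies the two copies; older homotopies extend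
       diagonally, with the sign of [- D]. *)
    pose S : 'M[R]_(m.+1 + m.+1) := block_mx 0 1%:M 0 0; exists S.
    transitivity (D' *m S + S *m D'); first by [].
    rewrite !mulmx_block !mulmx0 !mul0mx !mulmx1 !mul1mx !add0r !addr0 add_block_mx.
    rewrite -[RHS]/(a%:M : 'M[R]_(m.+1 + m.+1)).
    by rewrite !add0r addr0 addrN scalar_mx_block.
  pose S' : 'M[R]_(m.+1 + m.+1) := block_mx S 0 0 (- S); exists S'.
  transitivity (D' *m S' + S' *m D'); first by [].
  rewrite !mulmx_block !mulmx0 !mul0mx !add0r !addr0 !mulmxN !mulNmx !opprK add_block_mx.
  rewrite -[RHS]/(b%:M : 'M[R]_(m.+1 + m.+1)) scalar_mx_block.
  by rewrite E mul_scalar_mx mul_mx_scalar addrN addr0.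
- move=> j; rewrite E0.
  by have [[k ->]|[k ->]] := shiftP j; rewrite ?D'ul ?D'ur.
- move=> b; rewrite inE => /predU1P[->|/Dk[k E]].
    exists (rshift m.+1 (0 : 'I_m.+1)) => j; rewrite E0.
    have [[k ->]|[k ->]] := shiftP j.
      by rewrite D'dl mxE E0l eq_sym; case: eqP.
    by rewrite D'dr D0 oppr0 E0r.
  exists (lshift m.+1 k) => j; rewrite E0.
  have [[l ->]|[l ->]] := shiftP j; first by rewrite D'ul E E0l.
  by rewrite D'ur E0r.
- move=> k; rewrite E0 inE; have [[l ->]|[l ->]] := shiftP k.
    by rewrite D'ul; have [->|->] := DI l; [left | right; rewrite orbT].
  by rewrite D'dl mxE; case: eqP => _; [right; rewrite mulr1n eqxx | left].
Qed.

Section KoszulCohomology.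
Variables (R : comNzRingType) (m : nat) (D : 'M[R]_m.+1).
Hypothesis noeR : noetherian R.
Hypothesis DD : D *m D = 0.

Section Cocycles.
Variables (V : lmodType R).
Implicit Types S T B Z : V -> Prop.

Definition kcocycle S T (x : {ffun 'I_m.+1 -> V}) : Prop :=
  pw S x /\ pw T (mxact D x).

Definition kcobound S T (x : {ffun 'I_m.+1 -> V}) : Prop :=
  exists2 y, pw S y & pw T (x - mxact D y).

(* For T included in S, this is finite generation of the Koszul cohomology of
   the subquotient S / T. *)
Definition kfg S T : Prop := fg (kcocycle S T) (kcobound S T).

Lemma kcocycle_submodule S T : submodule S -> submodule T -> submodule (kcocycle S T).
Proof.
move=> subS subT; apply: submoduleI; first exact: pw_submodule.
exact/(submodule_preim (mxact D))/pw_submodule.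
Qed.

Lemma kcobound_submodule S T : submodule S -> submodule T -> submodule (kcobound S T).
Proof.
move=> subS subT; split.
  exists 0; first exact: pw_zero.
  by rewrite linear0 subr0; apply: pw_zero.
move=> a x x' [y Sy Txy] [y' Sy' Txy']; exists (a *: y + y').
  exact: pw_comb.
rewrite linearP opprD addrACA -scalerBr.
exact: pw_comb.
Qed.

Lemma mxact_DD (x : {ffun 'I_m.+1 -> V}) : mxact D (mxact D x) = 0.
Proof. by rewrite mxact_mul DD mxact0. Qed.

(** Induction on the coordinates in [r]: each new coordinate is a projection to [S], which is
    finitely generated modulo [T]. *)
Lemma fg_pw (P : {ffun 'I_m.+1 -> V} -> Prop) S T (r : seq 'I_m.+1) :
  submodule P -> submodule S -> submodule T -> (forall x, P x -> pw S x) ->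
  fg S T -> fg P (fun x => {in r, forall i, T (x i)}).
Proof.
move=> subP subS subT PS fgST; elim: r => [|i r IH]; first exact: fg_sub0.
apply: (fg_trans subP IH).
apply: (fg_rel (rho := fun (x : {ffun _ -> V}) w => w = x i) noeR _ subS subT _ _ _ fgST).
- apply: submoduleI => //; split=> [j _|a x y Tx Ty j jr]; rewrite !ffunE.
    exact: submodule0.
  by apply: submoduleP => //; [apply: Tx | apply: Ty].
- split=> [|a x y /= -> ->]; by rewrite !ffunE.
- by move=> x [Px _]; exists (x i); split=> //; apply: PS.
- by move=> x w [Px Tx] -> Txi j; rewrite inE => /predU1P[->|/Tx].
Qed.

(** Cocycles are already finitely generated modulo vectors with coordinates in [T], and these are
    coboundaries with primitive 0. *)
Lemma kfg_of_fg S T : submodule S -> submodule T -> fg S T -> kfg S T.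
Proof.
move=> subS subT fgST.
have [s [sc cs]] : fg (kcocycle S T) (fun x => {in enum 'I_m.+1, forall i, T (x i)}).
  by apply: fg_pw fgST => // [|x []] //; apply: kcocycle_submodule.
exists s; split=> // x /cs[y [sy Txy]]; exists y; split=> //.
exists 0; first exact: pw_zero.
by rewrite linear0 subr0 => i; apply: Txy; rewrite mem_enum.
Qed.

(* 0 -> B -> Z -> Z/B -> 0 *)
Lemma kfg_ext B Z : submodule B -> submodule Z -> (forall x, B x -> Z x) ->
  kfg B (fun x => x = 0) -> kfg Z B -> kfg Z (fun x => x = 0).
Proof.
move=> subB subZ BZ kB kZB; pose O := fun x : V => x = 0.
have subO : submodule O by apply: submodule_zero.
have subZO := kcocycle_submodule subZ subO.
(* Exactness of H(B) -> H(Z) -> H(Z/B) in the middle: first the image in H(Z/B), then the kernel,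
   which comes from H(B). *)
have fgZB : fg (kcocycle Z O) (kcobound Z B).
  apply: fg_sub kZB => //; first exact: kcobound_submodule.
  by move=> x [Zx /pw0 E]; split=> //; rewrite E; apply: pw_zero.
apply: (fg_trans subZO fgZB).
apply: (fg_rel (rho := fun x b => exists2 y, pw Z y & x = mxact D y + b)
  noeR _ _ _ _ _ _ kB).
- by apply: submoduleI => //; apply: kcobound_submodule.
- exact: kcocycle_submodule.
- exact: kcobound_submodule.
- split; first by exists 0; rewrite ?linear0 ?addr0 //; apply: pw_zero.
  move=> a [x b] [x' b'] /= [y Zy ->] [y' Zy' ->]; exists (a *: y + y').
    exact: pw_comb.
  by rewrite linearP scalerDr addrACA.
- move=> x [[Zx /pw0 Dx] [y Zy Bxy]]; exists (x - mxact D y); split.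
    by exists y; rewrite // addrC subrK.
  by split=> //; apply/pw0; rewrite linearB /= mxact_DD Dx subrr.
- move=> x b [[Zx _] _] [y Zy ->] [b' Bb' /pw0/subr0_eq ->]; exists (y + b').
    by apply: pwD => // i; apply: BZ.
  by rewrite linearD subrr => i; rewrite ffunE.
Qed.

End Cocycles.

Definition kacyclic (V : lmodType R) : Prop :=
  forall x : {ffun 'I_m.+1 -> V}, mxact D x = 0 -> exists y, x = mxact D y.

(* 0 -> ker d -> V -> im d -> 0 *)
Lemma kfg_shift (V W : lmodType R) (d : {linear V -> W}) : kacyclic V ->
  kfg (fun x => d x = 0) (fun x => x = 0) ->
  kfg (fun y => exists x, y = d x) (fun y => y = 0).
Proof.
move=> acV kZ.
have subO (U : lmodType R) : submodule (fun x : U => x = 0) by apply: submodule_zero.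
have subZ : submodule (fun x => d x = 0) by apply: (submodule_preim d (subO W)).
have subB : submodule (fun y => exists x, y = d x).
  by split=> [|a _ _ [u ->] [v ->]];
     [exists 0; rewrite linear0 | exists (a *: u + v); rewrite linearP].
(* The connecting map: lift [b] along [d] to [c], then apply [D]. *)
apply: (fg_rel (rho := fun b z => exists2 c, b = ffmap d c & z = mxact D c)
  noeR _ _ _ _ _ _ kZ).
- exact: kcocycle_submodule.
- exact: kcocycle_submodule.
- exact: kcobound_submodule.
- split; first by exists 0; rewrite /= linear0.
  move=> a [x b] [x' b'] /= [c -> ->] [c' -> ->]; exists (a *: c + c');
  by rewrite linearP.
- move=> b [/choice[c bc] /pw0 Db]; exists (mxact D (finfun c)); split.
    by exists (finfun c) => //; apply/ffunP => i; rewrite !ffunE.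
  split; last by apply/pw0; rewrite mxact_DD.
  have /pw0 : ffmap d (mxact D (finfun c)) = 0.
    rewrite ffmap_mxact -[RHS]Db; congr mxact.
    by apply/ffunP => i; rewrite !ffunE.
  by move=> Z i; have := Z i; rewrite ffunE.
(* From [D c = D y] with [d y = 0], acyclicity gives [c - y = D c'], so [b = d c] is the coboundary
   of [d c']. *)
- move=> b z _ [c -> ->] [y Zy /pw0]; rewrite -linearB => /acV[c' cy].
  exists (ffmap d c'); first by move=> i; rewrite ffunE; exists (c' i).
  rewrite -ffmap_mxact -cy -linearB opprB addrC subrK.
  by move=> i; rewrite ffunE Zy.
Qed.

End KoszulCohomology.

(** * Complexes of acyclic modules *)

Section AnnihilatedPart.
Variables (R : comNzRingType) (m : nat) (D : 'M[R]_m.+1) (s : seq R).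
Hypothesis noeR : noetherian R.
Hypothesis DD : D *m D = 0.
Hypothesis D0 : forall j, D 0 j = 0.
Hypothesis Dk : forall a, a \in s -> exists k, forall j, D k j = if j == 0 then a else 0.
Hypothesis DI : forall k, D k 0 = 0 \/ D k 0 \in s.

(** Column 0 of [D] has entries 0 or in [s], so [z e_0] is a cocycle and hence a coboundary; row 0
    of [D] vanishes, so its coordinate 0 is zero. *)
Lemma kacyclic_torsion_free (V : lmodType R) (z : V) : kacyclic D V ->
  {in s, forall a : R, a *: z = 0} -> z = 0.
Proof.
move=> acV sz; have [|y /ffunP/(_ 0)] := acV (ffdelta 0 z).
  by apply/ffunP => i; rewrite mxact_delta ffunE; have [->|/sz] := DI i; rewrite ?scale0r.
by rewrite !ffunE eqxx big1 // => j _; rewrite D0 scale0r.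
Qed.

(* z |-> D (z e_0) embeds (Z / B)[I] in the Koszul cohomology of B. *)
Lemma fg_annihilated (V : lmodType R) (Z B : V -> Prop) : submodule Z -> submodule B ->
  kacyclic D V -> kfg D B (fun x => x = 0) ->
  fg (fun z => Z z /\ {in s, forall a : R, B (a *: z)}) B.
Proof.
move=> subZ subB acV kB; have subO := submodule_zero V.
apply: (fg_rel (rho := fun z w => w = mxact D (ffdelta 0 z)) noeR _ _ _ _ _ _ kB).
- apply: submoduleI => //; split=> [a _|a x y xs ys b bs].
    by rewrite scaler0; apply: submodule0.
  rewrite scalerDr scalerA mulrC -scalerA.
  by apply: submoduleP => //; [apply: xs | apply: ys].
- exact: kcocycle_submodule.
- exact: kcobound_submodule.
- by split=> [|a x y /= -> ->]; rewrite /= ?linear0 // !linearP.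
- move=> z [_ zs]; exists (mxact D (ffdelta 0 z)); split=> //; split.
    move=> i; rewrite mxact_delta; have [->|/zs //] := DI i.
    by rewrite scale0r; apply: submodule0.
  by apply/pw0; rewrite mxact_DD.
(* If [D (z e_0) = D b], the row of [D] belonging to [a] gives [a (z - b_0) = 0] for every [a] in
   [s], hence [z = b_0] lies in [B]. *)
- move=> z w _ -> [b Bb /pw0]; rewrite -linearB => Dzb.
  suff /subr0_eq -> : z - b 0 = 0 by apply: Bb.
  apply: kacyclic_torsion_free => // a /Dk[k Dka].
  have /ffunP/(_ k) := Dzb; rewrite !ffunE (bigD1 0) //= big1 => [|j /negPf j0].
    by rewrite addr0 Dka eqxx !ffunE.
  by rewrite Dka j0 scale0r.
Qed.

Section Complex.
Variables (C : nat -> lmodType R) (d : forall n, {linear C n -> C n.+1}).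
Hypothesis dd : forall n x, d n.+1 (d n x) = 0.
Hypothesis acC : forall n, kacyclic D (C n).

Definition boundary n : C n -> Prop :=
  if n is j.+1 then fun x => exists y, x = d j y else fun x => x = 0.

Lemma boundary_submodule n : submodule (@boundary n).
Proof.
case: n => [|n]; first exact: submodule_zero.
by split=> [|a _ _ [u ->] [v ->]];
  [exists 0; rewrite linear0 | exists (a *: u + v); rewrite linearP].
Qed.

Lemma boundary_cycle n x : boundary x -> d n x = 0.
Proof. by case: n x => [|n] x; [move=> -> | case=> y ->]; rewrite ?linear0 ?dd. Qed.

Lemma fg_annihilated_homology t :
  (forall i, (i < t)%N -> fg (fun x => d i x = 0) (@boundary i)) ->
  fg (fun x => d t x = 0 /\ {in s, forall a : R, boundary (a *: x)}) (@boundary t).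
Proof.
move=> fgH; have subZ n : submodule (fun x => d n x = 0).
  exact: (submodule_preim (d n) (submodule_zero _)).
apply: fg_annihilated => //; first exact: boundary_submodule.
(* [kfg_ext] passes from the boundaries to the cycles in degree [t], and [kfg_shift] from there to
   the boundaries in degree [t.+1]. *)
elim: t fgH => [|t IH] fgH.
  apply: fg_sub0 => x [/pw0 -> _]; exists 0; first exact: (pw_zero (boundary_submodule 0)).
  by rewrite linear0 subr0; apply: (pw_zero (submodule_zero _)).
apply: kfg_shift => //; apply: (kfg_ext noeR DD (boundary_submodule t)) => //.
- exact: boundary_cycle.
- by apply: IH => i it; apply: fgH; apply: ltnW.
- by apply: kfg_of_fg => //; [apply: boundary_submodule | apply: fgH].
Qed.

End Complex.
End AnnihilatedPart.

(** * Homology modules and homomorphisms from R/I *)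

Section HomologyFinGen.
Variables (R : comNzRingType) (U V W : lmodType R).
Variables (f : {linear U -> V}) (g : {linear V -> W}).
Hypothesis noeR : noetherian R.

Lemma quot_pi_homology_eq0 (z : submod (lin_ker g)) :
  quot_pi (rel_submod (lin_ker g) (lin_im f)) z = 0 <->
  exists y, submod_val z = f y.
Proof.
split=> [/eqP|H]; first by rewrite quot_pi_eq0 => /asboolP.
by apply/eqP; rewrite quot_pi_eq0; apply/asboolP.
Qed.

Lemma cycleP x : g x = 0 -> exists z : submod (lin_ker g), submod_val z = x.
Proof. by move/eqP => gx; exists (Submod (gx : x \in lin_ker g)). Qed.

Lemma fg_of_homology : fin_gen (homology f g) ->
  fg (fun x => g x = 0) (fun x => exists y, x = f y).
Proof.
move=> /fin_gen_seq[u uS].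
have : fg (fun _ : homology f g => True) (fun x => x = 0).
  by exists u; split=> // x _; exists x; rewrite subrr.
apply: (fg_rel (rho := fun x w => exists2 z : submod (lin_ker g), submod_val z = x &
  quot_pi (rel_submod (lin_ker g) (lin_im f)) z = w) noeR) => //.
- exact: (submodule_preim g (submodule_zero _)).
- exact: submodule_zero.
- split; first by exists 0; rewrite ?linear0.
  move=> a [x w] [x' w'] [z /= <- <-] [z' /= <- <-]; exists (a *: z + z');
  by rewrite ?linearP.
- by move=> x /cycleP[z <-]; exists (quot_pi _ z); split=> //; exists z.
- by move=> x w _ [z <- <-] /quot_pi_homology_eq0.
Qed.

(** A homomorphism [phi] from R/I is determined by its value at 1, which [I] kills; [rho] relates
    [phi] to the cycles representing that value. *)
Lemma fin_gen_hom_homology (I : submodClosed R^o) (s : seq R) :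
  {in s, forall a, a \in I} ->
  fg (fun x => g x = 0 /\ {in s, forall a : R, exists y, a *: x = f y})
    (fun x => exists y, x = f y) ->
  fin_gen {linear quotmod I -> homology f g}.
Proof.
move=> sI fgH; apply/fin_gen_seq.
suff [u [_ uS]] : fg (fun _ : {linear quotmod I -> homology f g} => True) (fun x => x = 0).
  by exists u => x; have [//|y [uy /subr0_eq ->]] := uS x.
have subB : submodule (fun x => exists y, x = f y).
  by split=> [|a _ _ [u ->] [v ->]];
    [exists 0; rewrite linear0 | exists (a *: u + v); rewrite linearP].
pose pi1 := quot_pi I (1 : R^o).
have phi_pi (phi : {linear quotmod I -> homology f g}) r :
    phi (quot_pi I r) = r *: phi pi1.
  by rewrite -linearZ /pi1 -[_ *: quot_pi _ _]linearZ /= [_ *: _]mulr1.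
move: fgH; apply: (fg_rel (rho := fun (phi : {linear quotmod I -> homology f g}) x =>
  exists2 z : submod (lin_ker g), submod_val z = x &
  quot_pi (rel_submod (lin_ker g) (lin_im f)) z = phi pi1) noeR) => //.
- apply: submoduleI; first exact: (submodule_preim g (submodule_zero _)).
  split=> [a _|a x y xs ys b bs]; first by exists 0; rewrite scaler0 linear0.
  rewrite scalerDr scalerA mulrC -scalerA.
  by apply: (submoduleP subB); [apply: xs | apply: ys].
- split; first by exists 0; rewrite ?linear0.
  move=> a [x w] [x' w'] [z /= <- Ez] [z' /= <- Ez']; exists (a *: z + z') => //.
  by rewrite [LHS]linearP /= Ez Ez'.
- move=> phi _; set z := repr (phi pi1); exists (submod_val z); split.
    by exists z; rewrite ?quot_pi_repr.
  split=> [|a /sI aI]; first by have := valP z => /eqP.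
  have : quot_pi (rel_submod (lin_ker g) (lin_im f)) (a *: z) = 0.
    rewrite [LHS]linearZ /z /= quot_pi_repr -phi_pi.
    have /eqP -> : quot_pi I (a : R^o) == 0 by rewrite quot_pi_eq0.
    by rewrite linear0.
  by move/quot_pi_homology_eq0.
- move=> phi x _ [z <- Ez] /quot_pi_homology_eq0; rewrite Ez => phi1.
  apply: hom_ext => q; rewrite -[q]quot_pi_repr phi_pi phi1 scaler0.
  by [].
Qed.

End HomologyFinGen.

(** * The weak Artin-Rees lemma *)

(* The chain (Q : a^k) stabilizes, say at K; then (Q + a^K V) :&: L is still
   contained in Q, because a L is. Adding one generator of the ideal at a time
   avoids both the Rees algebra and a maximality argument. *)
Lemma weak_artin_rees (R : comNzRingType) (V : lmodType R) (L P : V -> Prop)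
    (s : seq R) : noetherian R -> fin_gen V -> submodule L -> submodule P ->
  {in s, forall (a : R) x, L x -> P (a *: x)} ->
  exists Q : V -> Prop, [/\ submodule Q, forall x, P x -> Q x,
    forall x, Q x -> L x -> P x &
    exists k, {in s, forall (a : R) x, Q (a ^+ k *: x)}].
Proof.
move=> noeR fgV subL subP; elim: s => [|a s IH] sLP.
  by exists P; split=> //; exists 0%N.
have [|Q [subQ PQ QL [k Qk]]] := IH.
  by move=> b bs; apply: sLP; rewrite inE bs orbT.
have Q_le i j x : (i <= j)%N -> Q (a ^+ i *: x) -> Q (a ^+ j *: x).
  by move=> /subnKC <- Qx; rewrite exprD mulrC -scalerA; apply: submoduleZ.
(* The union of the chain [(Q : a^k)]; a finite generating list of it yields the exponent [K] at
   which the chain stabilizes. *)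
pose U x := exists k, Q (a ^+ k *: x).
have subU : submodule U.
  split; first by exists 0%N; rewrite scaler0; apply: submodule0.
  move=> r x y [i Qx] [j Qy]; exists (maxn i j); rewrite scalerDr scalerA mulrC -scalerA.
  apply: submoduleP => //; [apply: Q_le Qx | apply: Q_le Qy];
  by rewrite ?leq_maxl ?leq_maxr.
have [u [uU Us]] : fg U (fun x => x = 0).
  have /fin_gen_seq[v vV] := fgV; apply: (fg_of_span (s := v)) => // [|x _].
    exact: submodule_zero.
  by exists x; rewrite subrr.
have {uU}[K uK] : exists K, {in u, forall x, Q (a ^+ K *: x)}.
  elim: u uU {Us} => [|y u IHu] uU; first by exists 0%N.
  have [|K uK] := IHu; first by move=> x xu; apply: uU; rewrite inE xu orbT.
  have [j Qy] := uU y (mem_head _ _); exists (maxn j K) => x.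
  rewrite inE => /predU1P[->|/uK]; first exact: (Q_le _ _ _ (leq_maxl _ _) Qy).
  exact: (Q_le _ _ _ (leq_maxr _ _)).
have UK x : U x -> Q (a ^+ K *: x).
  move=> /Us[y [uy /subr0_eq ->]]; move: y uy; apply: lspan_in => //.
  split; first by rewrite scaler0; apply: submodule0.
  by move=> r y z Qy Qz; rewrite scalerDr scalerA mulrC -scalerA; apply: submoduleP.
exists (addsub Q (fun y => exists w, y = a ^+ K *: w)); split.
- apply: addsub_submodule => //; split; first by exists 0; rewrite scaler0.
  move=> r _ _ [w ->] [w' ->]; exists (r *: w + w').
  by rewrite scalerDr !scalerA mulrC.
- by move=> x /PQ Qx; exists x; split=> //; exists 0; rewrite subrr scaler0.
- move=> x [q [Qq [w E]]] Lx; apply: (QL) => //.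
  (* As [a x] lies in [P] and hence in [Q], so does [a^(K+1) w = a x - a q]; thus [w] is in [U], and
     stability brings [a^K w] into [Q]. *)
  rewrite -(subrK q x) E; apply: submoduleD => //; apply: UK; exists K.+1.
  rewrite exprS -scalerA -E scalerBr; apply: submoduleB; [by []| |exact: submoduleZ].
  by apply: PQ; apply: sLP => //; apply: mem_head.
exists (maxn k K) => b; rewrite inE => /predU1P[->|bs] x.
  exists 0; split; first exact: submodule0.
  exists (a ^+ (maxn k K - K) *: x).
  by rewrite subr0 scalerA -exprD subnKC // leq_maxr.
exists (b ^+ maxn k K *: x); split; last by exists 0; rewrite subrr scaler0.
by rewrite -(subnKC (leq_maxl k K)) exprD -scalerA; apply: Qk.
Qed.

(** * Powers of a finitely generated ideal *)

Lemma prod_lspan_cons (R : comNzRingType) (a : R^o) (s l : seq R^o) :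
  {in l, forall x, lspan (a :: s) x} ->
  exists (b : R) (l' : seq R^o), [/\ size l' = size l, {in l', forall x, lspan s x} &
    \prod_(x <- l) (x : R) = a * b + \prod_(x <- l') (x : R)].
Proof.
elim: l => [|x l IH] ls.
  by exists 0, [::]; split=> //; rewrite !big_nil mulr0 add0r.
have [|b [l' [szl' sl' E]]] := IH; first by move=> y yl; apply: ls; rewrite inE yl orbT.
have [r sxr] := ls x (mem_head _ _).
exists (r * \prod_(y <- l) (y : R) + (x - r *: a : R) * b), ((x - r *: a) :: l').
split=> [/=|y|]; first by rewrite szl'.
  by rewrite inE => /predU1P[->|/sl'].
rewrite !big_cons mulrDr -addrA.
rewrite [a * (_ * b)]mulrCA -mulrDr -E mulrA [a * r]mulrC -mulrDl.
by rewrite -[r * a]/(r *: a) addrC subrK.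
Qed.

(* By descending induction on j, products of many elements of (a :: s) lie in
   (J : a^j). *)
Lemma prod_lspan_pow (R : comNzRingType) (k : nat) (s : seq R^o) (J : R^o -> Prop) :
  submodule J -> {in s, forall a : R, J (a ^+ k)} ->
  exists K, forall l : seq R^o, size l = K -> {in l, forall x, lspan s x} ->
    J (\prod_(x <- l) (x : R)).
Proof.
elim: s J => [|a s IH] J subJ sJ.
  (* One factor is required: it is 0, whereas the empty product 1 need not lie in [J]. *)
  exists 1%N => -[|x []] // _ /(_ x (mem_head _ _)) /= ->.
  by rewrite big_seq1; apply: (submodule0 subJ).
have mulJ (r x : R) : J x -> J (r * x) by exact: (submoduleZ subJ).
suff H i : (i <= k)%N -> exists K, forall l : seq R^o, size l = K ->
    {in l, forall x, lspan (a :: s) x} -> J (a ^+ (k - i) * \prod_(x <- l) (x : R)).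
  have [K HK] := H k (leqnn k); exists K => l lK ls.
  by have := HK l lK ls; rewrite subnn expr0 mul1r.
elim: i => [_|i IHi ik].
  exists 0%N => l _ _; rewrite subn0 mulrC; apply: mulJ.
  by apply: sJ; apply: mem_head.
have [K1 HK1] := IHi (ltnW ik).
have [||K2 HK2] := IH (fun r : R^o => J (a ^+ (k - i.+1) * (r : R))).
- split; first by rewrite mulr0; apply: (submodule0 subJ).
  move=> r x y Jx Jy; rewrite mulrDr -[r *: x]/(r * x) mulrCA.
  exact: (submoduleP subJ).
- by move=> b bs; apply: mulJ; apply: sJ; rewrite inE bs orbT.
(* The first [K2] factors multiply to [a b] plus a product over [s]. The term [a b] raises the power
   of [a], and the last [K1] factors finish it by [IHi]; the other term falls to [IH] for the ideal
   [(J : a^(k-i-1))]. *)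
exists (K2 + K1)%N => l szl ls.
have [|b [l' [szl' sl' E]]] := @prod_lspan_cons _ a s (take K2 l).
  by move=> x /mem_take /ls.
rewrite -(cat_take_drop K2 l) big_cat /= E mulrDl mulrDr.
apply: (submoduleD subJ).
  have -> (x : R) : a ^+ (k - i.+1) * (a * b * x) = b * (a ^+ (k - i) * x).
    by rewrite -(subnSK ik) exprSr -!mulrA [RHS]mulrCA; congr (_ * _); apply: mulrCA.
  apply: mulJ; apply: HK1; first by rewrite size_drop szl addKn.
  by move=> x /mem_drop /ls.
rewrite mulrA mulrC; apply: mulJ; apply: HK2 => //.
by rewrite szl' size_takel // szl leq_addr.
Qed.

Lemma ideal_pow_sub (R : comNzRingType) (I : submodClosed R^o) (k : nat)
    (s : seq R^o) (J : R^o -> Prop) :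
  (forall x, x \in I -> lspan s x) -> submodule J -> {in s, forall a : R, J (a ^+ k)} ->
  exists K, forall x, x \in ideal_pow I K -> J x.
Proof.
move=> Is subJ sJ; have [K HK] := prod_lspan_pow subJ sJ; exists K.
apply: span_ind => // _ [a [aI ->]].
have -> : \prod_(i < K) a i = \prod_(x <- [seq a i | i : 'I_K]) x.
  by rewrite big_image.
apply: HK; first by rewrite size_image card_ord.
by move=> _ /codomP[i ->]; apply: Is.
Qed.

(** * Maps into injective modules *)

(** The condition on kernels makes [psi] factor through the image of [phi], and injectivity of [E]
    extends the factor to [V]. *)
Lemma injective_extension (R : comNzRingType) (E U V : lmodType R)
    (phi : {linear U -> V}) (psi : {linear U -> E}) : injective_module E ->
  (forall u, phi u = 0 -> psi u = 0) ->
  exists g : {linear V -> E}, forall u, g (phi u) = psi u.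
Proof.
move=> injE ker_sub.
have /choice[r rP] (y : submod (lin_im phi)) : exists u, submod_val y = phi u.
  by have := valP y => /asboolP.
pose h y := psi (r y).
have psi_eq u v : phi u = phi v -> psi u = psi v.
  move=> E'; apply/subr0_eq; rewrite -linearB; apply: ker_sub.
  by rewrite linearB E' subrr.
have h_lin : linear h.
  move=> a x y; rewrite /h -linearP; apply: psi_eq.
  by rewrite linearP -!rP.
pose hL := GRing.isLinear.Build R _ _ _ h h_lin.
pose H : {linear submod (lin_im phi) -> E} := HB.pack h hL.
have [g gE] := injE _ _ (\val : {linear submod (lin_im phi) -> V}) H val_inj.
exists g => u; have uim : phi u \in lin_im phi by apply/asboolP; exists u.
rewrite -[phi u]/(val (Submod uim)) gE; apply: psi_eq.
by rewrite -rP.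
Qed.

(** * Acyclicity of the ideal transform of an injective module *)

Section DirectedColimit.
Variables (R : comNzRingType) (A : dirsys R).

Lemma dprod_sumE (J : Type) (r : seq J) (F : J -> dprod A) n :
  (\sum_(i <- r) F i) n = \sum_(i <- r) F i n.
Proof. by elim/big_rec2: _ => // i y x _ <-. Qed.

Lemma dprod_single_id n (a : A n) : dprod_single a n = a.
Proof. exact: dfwith_in. Qed.

Lemma dprod_single_ne n k (a : A n) : n != k -> dprod_single a k = 0.
Proof. by move=> nk; apply: dfwith_out. Qed.

Lemma dsum_in_linear n : linear (@dsum_in R A n).
Proof.
move=> a x y; apply: val_inj; apply: dprod_ext => k.
change (dprod_single (a *: x + y) k = a *: dprod_single x k + dprod_single y k).
have [<-|nk] := eqVneq n k; first by rewrite !dprod_single_id.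
by rewrite !dprod_single_ne // scaler0 addr0.
Qed.
HB.instance Definition _ n :=
  GRing.isLinear.Build R (A n) (dsum A) _ (@dsum_in R A n) (@dsum_in_linear n).

Lemma colim_in_linear n : linear (@colim_in R A n).
Proof. by move=> a x y; rewrite /colim_in linearP [LHS]linearP. Qed.
HB.instance Definition _ n :=
  GRing.isLinear.Build R (A n) (colim A) _ (@colim_in R A n) (@colim_in_linear n).

Lemma colim_in_map i j (h : (i <= j)%N) (a : A i) :
  colim_in (dsmap h a) = colim_in a.
Proof.
apply/esym/eqP; rewrite -subr_eq0 /colim_in.
rewrite -[X in X == _]linearB quot_pi_eq0; apply: mem_span.
by exists i, j, h, a.
Qed.

(** All components of a representative are pushed to a stage [n] bounding its support and added
    there. *)
Lemma colim_in_surj (x : colim A) : exists n (a : A n), x = colim_in a.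
Proof.
rewrite -[x]quot_pi_repr; move: (repr x) => {x} y.
have [n yn] : exists n, forall k, (n <= k)%N -> submod_val y k = 0.
  by have := valP y => /asboolP.
exists n, (\sum_(i < n) dsmap (ltnW (ltn_ord i)) (submod_val y i)).
rewrite linear_sum; under eq_bigr => i _ do rewrite /= colim_in_map.
rewrite -[RHS](linear_sum (quot_pi (colim_rel A))); congr quot_pi.
apply: val_inj; rewrite raddf_sum; apply: dprod_ext => k.
rewrite dprod_sumE; have [nk|kn] := leqP n k.
  rewrite [LHS]yn // big1 // => i _; apply: dprod_single_ne.
  by rewrite neq_ltn (leq_trans (ltn_ord i) nk).
rewrite (bigD1 (Ordinal kn)) //= dprod_single_id big1 ?addr0 // => i ik.
exact: dprod_single_ne.
Qed.

(** Components beyond stage [N] are dropped, so a defining relation of the limit is sent to 0 only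
    once [N] reaches its target stage. *)
Definition push N (x : dsum A) : A N :=
  \sum_(i < N.+1) dsmap (leq_ord i) (submod_val x i).

Lemma push_linear N : linear (push N).
Proof.
move=> a x y; rewrite /push scaler_sumr -big_split; apply: eq_bigr => i _.
exact: (linearP (dsmap (leq_ord i))).
Qed.
HB.instance Definition _ N :=
  GRing.isLinear.Build R (dsum A) (A N) _ (push N) (push_linear N).

Lemma push_in i N (h : (i <= N)%N) (a : A i) : push N (dsum_in a) = dsmap h a.
Proof.
have iN : (i < N.+1)%N by [].
rewrite /push (bigD1 (Ordinal iN)) //= dprod_single_id big1 => [|j ji].
  by rewrite addr0; congr (dsmap _ _); apply: eq_irrelevance.
by rewrite dprod_single_ne ?linear0 // eq_sym.
Qed.

(** An element of [colim_rel] is killed by [push N] for all large [N], and on a single component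
    [push N] is the transition map. *)
Lemma colim_in_eq0 i (a : A i) :
  colim_in a = 0 -> exists j (h : (i <= j)%N), dsmap h a = 0.
Proof.
move/eqP; rewrite quot_pi_eq0 => arel.
have [N pushN] : exists N0, forall N, (N0 <= N)%N -> push N (dsum_in a) = 0.
  move: (dsum_in a) arel; apply: span_ind => [|_ [k [j [h [b ->]]]]].
    split; first by exists 0%N => N _; rewrite linear0.
    move=> r x y [n xn] [m ym]; exists (maxn n m) => N.
    by rewrite geq_max => /andP[nN mN]; rewrite linearP /= xn // ym // scaler0 addr0.
  exists j => N jN; rewrite linearB /= (push_in jN) (push_in (leq_trans h jN)).
  by rewrite (dsmap_comp h jN (leq_trans h jN)) subrr.
exists (maxn N i), (leq_maxr _ _).
by rewrite -push_in pushN // leq_maxl.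
Qed.

Lemma colim_in_family m (x : 'I_m -> colim A) :
  exists n (a : 'I_m -> A n), forall i, x i = colim_in (a i).
Proof.
have /choice[p pE] i : exists p : {n & A n}, x i = colim_in (projT2 p).
  by have [n [a ->]] := colim_in_surj (x i); exists (existT _ n a).
have le i : (projT1 (p i) <= \max_j projT1 (p j))%N by exact: (leq_bigmax i).
exists (\max_j projT1 (p j))%N, (fun i => dsmap (le i) (projT2 (p i))) => i.
by rewrite colim_in_map.
Qed.

Lemma colim_in_eq0_family m n (a : 'I_m -> A n) : (forall i, colim_in (a i) = 0) ->
  exists N (h : (n <= N)%N), forall i, dsmap h (a i) = 0.
Proof.
move=> a0; have /choice[p pE] i : exists j, exists h : (n <= j)%N, dsmap h (a i) = 0.
  exact: colim_in_eq0.
exists (maxn n (\max_j p j)), (leq_maxl _ _) => i; have [h E] := pE i.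
have le : (p i <= maxn n (\max_j p j))%N.
  by apply: leq_trans (leq_maxr _ _); apply: (leq_bigmax i).
by rewrite -(dsmap_comp h le) E linear0.
Qed.

End DirectedColimit.

Section FunctionSum.
Variables (R : comNzRingType) (V E : lmodType R) (n : nat).
Variable f : 'I_n -> {linear V -> E}.

(** Views a vector of homomorphisms as one homomorphism on a power of [V]; a matrix acting on the
    vector becomes precomposition with its transpose. *)
Definition ffsum (x : {ffun 'I_n -> V}) : E := \sum_j f j (x j).

Lemma ffsum_linear : linear ffsum.
Proof.
move=> a x y; rewrite /ffsum scaler_sumr -big_split; apply: eq_bigr => j _.
by rewrite !ffunE linearP.
Qed.
HB.instance Definition _ :=
  GRing.isLinear.Build R {ffun 'I_n -> V} E _ ffsum ffsum_linear.

Lemma ffsum_mxact m (B : 'M[R]_(n, m)) (x : {ffun 'I_m -> V}) :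
  ffsum (mxact B x) = \sum_i (\sum_j B j i *: f j (x i)).
Proof.
rewrite /ffsum exchange_big; apply: eq_bigr => j _.
by rewrite ffunE linear_sum; apply: eq_bigr => i _; rewrite linearZ.
Qed.

Lemma ffsum_delta i v : ffsum (ffdelta i v) = f i v.
Proof.
rewrite /ffsum (bigD1 i) //= ffunE eqxx big1 ?addr0 // => j /negPf ji.
by rewrite ffunE ji linear0.
Qed.

End FunctionSum.

Lemma hom_sumE (R : comNzRingType) (U V : lmodType R) (J : Type) (r : seq J)
    (F : J -> {linear U -> V}) x : (\sum_(i <- r) F i) x = \sum_(i <- r) F i x.
Proof. by elim/big_rec2: _ => // i y z _ <-. Qed.

Lemma fin_gen_submod (R : comNzRingType) (M : lmodType R) (S : submodClosed M) :
  noetherian R -> fin_gen M -> fin_gen (submod S).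
Proof.
move=> noeR /fin_gen_seq[s sM]; apply/fin_gen_seq.
have fgM : fg (fun _ : M => True) (fun x => x = 0).
  by exists s; split=> // x _; exists x; rewrite subrr.
have [u [_ uS]] : fg (fun _ : submod S => True) (fun x => x = 0).
  move: fgM; apply: (fg_rel (rho := fun (x : submod S) y => submod_val x = y) noeR) => //.
  - exact: submodule_zero.
  - by split=> // a [x y] [x' y'] /= <- <-.
  - by move=> x _; exists (submod_val x).
  - by move=> x y _ xy y0; apply: val_inj; rewrite /= xy.
by exists u => x; have [//|y [uy /subr0_eq ->]] := uS x.
Qed.

Lemma fin_gen_ffun (R : comNzRingType) (M : lmodType R) m :
  noetherian R -> fin_gen M -> fin_gen {ffun 'I_m.+1 -> M}.
Proof.
move=> noeR /fin_gen_seq[s sM]; apply/fin_gen_seq.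
have fgM : fg (fun _ : M => True) (fun x => x = 0).
  by exists s; split=> // x _; exists x; rewrite subrr.
have [u [_ uS]] : fg (fun _ : {ffun 'I_m.+1 -> M} => True)
    (fun x => {in enum 'I_m.+1, forall i, x i = 0}).
  by apply: fg_pw fgM => //; apply: submodule_zero.
exists u => x; have [//|y [uy xy]] := uS x; suff /subr0_eq -> : x - y = 0 by [].
by apply/pw0 => i; apply: xy; rewrite mem_enum.
Qed.

(** Induction principle expressing [I^(n+k) M = I^k (I^n M)]: a product of [n + k] elements is split
    into its first [n] and last [k] factors. *)
Lemma ideal_powMD (R : comNzRingType) (I : submodClosed R^o) (M : lmodType R) n k
    (P : M -> Prop) : submodule P ->
  (forall (r : R) m, r \in ideal_pow I k -> m \in ideal_powM I M n -> P (r *: m)) ->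
  forall x, x \in ideal_powM I M (n + k) -> P x.
Proof.
move=> subP rmP; apply: span_ind => // _ [r [m [rI ->]]].
move: r rI; apply: (@span_ind R R^o _ (fun r : R^o => P ((r : R) *: m)))
  => [|_ [a [aI ->]]].
  split; first by rewrite scale0r; apply: submodule0.
  by move=> r x y Px Py; rewrite scalerDl -scalerA; apply: submoduleP.
rewrite big_split_ord /= mulrC -scalerA; apply: rmP.
  by apply: mem_span; exists (fun i => a (rshift n i)); split.
apply: mem_span; exists (\prod_(i < n) a (lshift k i)), m; split=> //.
by apply: mem_span; exists (fun i => a (lshift k i)); split.
Qed.

Lemma ideal_transform_acyclic (R : comNzRingType) (I : submodClosed R^o)
    (M E : lmodType R) (s : seq R^o) m (D : 'M[R]_m.+1) :
  noetherian R -> fin_gen M -> injective_module E ->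
  (forall x, x \in I -> lspan s x) ->
  {in s, forall a : R, exists S, D *m S + S *m D = a%:M} ->
  D *m D = 0 -> kacyclic D (colim (hom_powM_sys I M E)).
Proof.
move=> noeR fgM injE Is DS DD x Dx.
have [n0 [f0 xE0]] := colim_in_family x.
(* At a late enough stage [n] the representatives satisfy the cocycle equation exactly, not just in
   the limit. *)
have /colim_in_eq0_family[n [h fn]] i : colim_in (\sum_j D i j *: f0 j) = 0.
  have /ffunP/(_ i) := Dx; rewrite !ffunE => Dxi; rewrite -[RHS]Dxi linear_sum.
  by apply: eq_bigr => j _; rewrite linearZ xE0.
pose f i := dsmap h (f0 i).
have xE i : x i = colim_in (f i) by rewrite xE0 colim_in_map.
have Df i y : \sum_j D i j *: f j y = 0.
  have := congr1 (fun g : {linear submod (ideal_powM I M n) -> E} => g y) (fn i).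
  rewrite linear_sum hom_sumE => E0; rewrite -[RHS]E0.
  by apply: eq_bigr => j _; rewrite linearZ.
pose Y := submod (ideal_powM I M n).
have fgY : fin_gen {ffun 'I_m.+1 -> Y} by apply/fin_gen_ffun/fin_gen_submod.
have [|||Q [subQ PQ QL [k Qk]]] := @weak_artin_rees R {ffun 'I_m.+1 -> Y}
  (fun y => mxact D^T y = 0) (fun y => exists u, y = mxact D^T u) s noeR fgY.
- exact: (submodule_preim (mxact D^T) (submodule_zero _)).
- split; first by exists 0; rewrite linear0.
  by move=> a _ _ [u ->] [v ->]; exists (a *: u + v); rewrite linearP.
(* The transposed homotopy shows that [a] carries ker D^T into im D^T. *)
- move=> a /DS[S DSa] y Ly; exists (mxact S^T y).
  rewrite -mxact_scalar -tr_scalar_mx -DSa linearD /= !trmx_mul mxactD.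
  by rewrite -!mxact_mul Ly linear0 add0r.
(* The ideal of all [r] multiplying every vector into [Q] contains [a^k] for [a] in [s], hence
   [I^K]. So vectors over [I^(n+K) M] lie in [Q]. *)
have [||K HK] := @ideal_pow_sub _ I k s (fun r : R^o => forall y, Q ((r : R) *: y)) Is.
- split; first by move=> y; rewrite scale0r; apply: submodule0.
  by move=> r a b Qa Qb y; rewrite scalerDl -scalerA; apply: submoduleP.
- by move=> a /Qk.
have leK : (n <= n + K)%N by exact: leq_addr.
pose Y' := submod (ideal_powM I M (n + K)).
pose incl : {linear Y' -> Y} := submod_incl (ideal_powM_anti leK).
have inQ (y : {ffun 'I_m.+1 -> Y'}) : Q (ffmap incl y).
  rewrite [ffmap _ _]ffun_sum_delta; apply: submodule_sum => // i; rewrite ffunE.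
  pose G v := exists2 w : Y, submod_val w = v & Q (ffdelta i w).
  suff H v : v \in ideal_powM I M (n + K) -> G v.
    have [w wE Qw] := H _ (valP (y i)); suff -> : incl (y i) = w by [].
    exact: val_inj.
  apply: (@ideal_powMD _ I M n K G) => [|r v' rI vI].
    split; first by exists 0; rewrite ?linear0 //; apply: submodule0.
    move=> a _ _ [w <- Qw] [w' <- Qw']; exists (a *: w + w') => //.
    by rewrite linearP; apply: submoduleP.
  by exists (r *: (Submod vI : Y)); rewrite // linearZ; apply: HK.
(* Over [I^(n+K) M] a vector in ker D^T equals [D^T w] with [w] over [I^n M], and [f] kills it by
   the cocycle equation; so the restriction of [f] factors as [g] after [D^T]. *)
have [u Du|g gE] := @injective_extension R E _ _ (mxact D^T)
    (ffsum (fun j => hom_comp (f j) incl)) injE.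
  have [w wE] : exists w, ffmap incl u = mxact D^T w.
    by apply: QL => //; rewrite -ffmap_mxact Du linear0.
  transitivity (ffsum f (ffmap incl u)).
    by apply: eq_bigr => j _; rewrite ffunE.
  rewrite wE ffsum_mxact big1 // => i _.
  by under eq_bigr do rewrite mxE; apply: Df.
(* The components of [g] form the primitive: coordinate [i] of its image under [D] is [g] on
   [D^T (v e_i)], which is [f i v]. *)
exists [ffun j => colim_in (hom_comp g (ffdelta j) : hom_powM_sys I M E (n + K))].
apply/ffunP => i; rewrite xE -(colim_in_map leK) ffunE.
under eq_bigr do rewrite ffunE -linearZ.
rewrite -linear_sum; congr colim_in; apply: hom_ext => v.
transitivity (g (mxact D^T (ffdelta i v))).
  rewrite gE; transitivity (hom_comp (f i) incl v) => //.
  by rewrite -(ffsum_delta (fun j => hom_comp (f j) incl)).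
rewrite hom_sumE [mxact _ _]ffun_sum_delta linear_sum; apply: eq_bigr => j _.
by rewrite mxact_delta mxE !linearZ.
Qed.

(** * Derived functors of the ideal transform *)

Lemma fmap_hom0 (R : comNzRingType) (F : additive_functor R) (A B : lmodType R) x :
  fmap F (hom0 A B) x = 0.
Proof.
have := @fmap_add _ F _ _ (hom0 A B) (hom0 A B) x.
rewrite (_ : hom_add _ _ = hom0 A B); last by apply: hom_ext => y; rewrite /= addr0.
by move/eqP; rewrite -subr_eq0 opprD addNKr oppr_eq0 => /eqP.
Qed.

Theorem theorem2p10 (R : comNzRingType) (I : submodClosed R^o)
    (M N : lmodType R) (E : injective_resolution N) (t : nat) :
  noetherian R ->
  fin_gen M ->
  (forall i, (i < t)%N -> fin_gen (right_derived (ideal_transform I M) E i)) ->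
  fin_gen {linear quotmod I -> right_derived (ideal_transform I M) E t}.
Proof.
move=> noeR fgM fgH.
have [s sI Is] := noetherian_fg noeR (submodule_mem I).
have [m [D [DD DS D0 Dk DI]]] := koszul_matrix (s : seq R).
pose d n := fmap (ideal_transform I M) (idiff E n).
have dd n x : d n.+1 (d n x) = 0.
  rewrite /d -[LHS]/((fmap (ideal_transform I M) (idiff E n.+1) \o
    fmap (ideal_transform I M) (idiff E n)) x) -fmap_comp.
  rewrite (_ : hom_comp _ _ = hom0 _ _) ?fmap_hom0 //; apply: hom_ext => y /=.
  by apply/iexactS; exists y.
have acC n : kacyclic D (ideal_transform I M (E n)).
  exact: (ideal_transform_acyclic noeR fgM (@iobj_inj _ _ E n) Is DS DD).
have subHom := fg_annihilated_homology noeR DD D0 Dk DI dd acC.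
(* In degree 0 [right_derived] divides by the image of [hom0], while [boundary] is the zero
   submodule; this reconciles the two. *)
have hom0P (U V : lmodType R) (x : V) : (x = 0) = (exists y, x = hom0 U V y).
  by apply/propext; split=> [->|[y ->]] //; exists 0.
have fgB i : (i < t)%N -> fg (fun x => d i x = 0) (@boundary _ _ d i).
  move=> /fgH; case: i => [|i] /(fg_of_homology noeR) //=.
  by apply: eq_fg => x //; rewrite -hom0P.
move: (subHom t fgB); case: t {fgH fgB subHom} => [|t] fgB.
  apply: (fin_gen_hom_homology noeR (s := s)) => //; move: fgB => /=.
  apply: eq_fg => x; last by rewrite -hom0P.
  by split=> -[dx sx]; split=> // a /sx; rewrite -hom0P.
exact: (fin_gen_hom_homology noeR (s := s)).
Qed.
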